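(* Let $n\in\mathbb{N}$, let $T$ be a set of arithmetical sentences and let $\Gamma$ be a sequent. If $\Gamma$ is provable in $\mathsf{S}^{\Pi}_n$ from assumptions $T$, then $\Gamma$ (i.e. the formula $\bigvee\Gamma$) is a theorem of $\mathsf{Q}+T+\Pi_{n+1}\text{-}\mathsf{IR}$.
   Context: **Formulas and sequents.** Arithmetical terms are built from individual variables $\mathit{Var}=\{x_0,x_1,\dots\}$ and the constant $0$ by the unary symbol $s$ and the binary symbols $+,\cdot$. Arithmetical formulas are given by $\varphi::=t=t\mid t\neq t\mid(\varphi\wedge\varphi)\mid(\varphi\vee\varphi)\mid\forall y\,\varphi\mid\exists y\,\varphi$. Negation $\overline{\varphi}$ is the syntactic operation swapping $=$ with $\neq$, $\wedge$ with $\vee$, $\forall$ with $\exists$ (so $\overline{\overline\varphi}=\varphi$). Put $\bot:=0\neq 0$, $\varphi\to\psi:=\overline\varphi\vee\psi$. $x\leq y$ abbreviates $\exists z\,(z+x=y)$. $\varphi[y\mapsto t]$ is the substitution of $t$ for all free occurrences of $y$ (no variable of $t$ may become bound). A sequent is a finite multiset of formulas, interpreted as $\bigvee\Gamma$ (with $\bigvee\emptyset:=\bot$); the comma denotes multiset union. $\mathit{FV}$ denotes the set of free variables. **Classes.** Bounded quantifiers: $\forall y\leq t\,\varphi:=\forall y(y\leq t\to\varphi)$, $\exists y\leq t\,\varphi:=\exists y(y\leq t\wedge\varphi)$, with $y$ not in $t$. $\Delta_0=\Sigma_0=\Pi_0$ is the set of formulas built from atomic formulas by logical connectives and bounded quantifiers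 only. A formula is $\Sigma_{n+1}$ (resp. $\Pi_{n+1}$) if it is obtained from $\Pi_n$ (resp. $\Sigma_n$) formulas using existential (resp. universal) quantifiers and $\wedge,\vee$. **Theories.** Robinson's arithmetic $\mathsf{Q}$: first-order logic with equality plus (universal closures of) $\neg s(x)=0$; $s(x)=s(y)\to x=y$; $x=0\vee\exists y\,x=s(y)$; $x+0=x$; $x+s(y)=s(x+y)$; $x\cdot0=0$; $x\cdot s(y)=x\cdot y+x$. The induction rule $(\mathrm{IR})$: from $\varphi(0)$ and $\forall x(\varphi(x)\to\varphi(s(x)))$ infer $\forall x\,\varphi(x)$. For a theory $U$, $U+\Pi_m\text{-}\mathsf{IR}$ is the closure of $U$ (under logical consequence and) under $(\mathrm{IR})$ for $\Pi_m$ formulas $\varphi$. **Calculus $\mathsf{SQ}$.** Initial sequents: $\Gamma,t_0=t_1,t_0\neq t_1$ and $\Gamma,s(t)\neq0$. Rules (premisses / conclusion): $(\wedge)$: $\Gamma,\varphi$ and $\Gamma,\psi$ / $\Gamma,\varphi\wedge\psi$; $(\vee)$: $\Gamma,\varphi,\psi$ / $\Gamma,\varphi\vee\psi$; $(\forall)$: $\Gamma,\varphi[y\mapsto z]$ / $\Gamma,\forall y\,\varphi$, where $z\notin\mathit{FV}(\Gamma,\forall y\,\varphi)$ ($z$ is the active variable); $(\exists)$: $\Gamma,\varphi[y\mapsto t],\exists y\,\varphi$ / $\Gamma,\exists y\,\varphi$; $(\mathsf{ref})$: $\Gamma,t\neq t$ / $\Gamma$; $(\mathsf{rep})$: $\Gamma,t_0\neq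 t_1,(u_0\neq u_1)[y\mapsto t_0],(u_0\neq u_1)[y\mapsto t_1]$ / $\Gamma,t_0\neq t_1,(u_0\neq u_1)[y\mapsto t_0]$; $(\mathsf{add}_0)$: $\Gamma,t+0\neq t$ / $\Gamma$; $(\mathsf{add}_s)$: $\Gamma,t+s(u)\neq s(t+u)$ / $\Gamma$; $(\mathsf{mult}_0)$: $\Gamma,t\cdot0\neq0$ / $\Gamma$; $(\mathsf{mult}_s)$: $\Gamma,t\cdot s(u)\neq t\cdot u+t$ / $\Gamma$; $(\mathsf{pred})$: $\Gamma,s(t_0)\neq s(t_1),t_0\neq t_1$ / $\Gamma,s(t_0)\neq s(t_1)$; $(\mathsf{case})$: left premiss $\Gamma[y\mapsto0]$ and right premiss $\Gamma[y\mapsto s(y)]$ / $\Gamma$, where $y\in\mathit{FV}(\Gamma)$ ($y$ is the active variable); $(\mathsf{weak})$: $\Gamma$ / $\Gamma,\Delta$; $(\mathsf{cut})$: left premiss $\Gamma,\varphi$ and right premiss $\Gamma,\overline\varphi$ / $\Gamma$. **Proofs of $\mathsf{S}^{\Pi}_n$ from assumptions.** An $\infty$-proof from assumptions $T$ is a possibly infinite tree whose nodes are marked by sequents, constructed according to the rules of $\mathsf{SQ}$, with every leaf marked by an initial sequent of $\mathsf{SQ}$ or by a sequent $\{\varphi\}$ with $\varphi\in T$, such that every infinite branch has a tail satisfying conditions (a)–(c) below. It is an $\infty$-proof of $\mathsf{S}^{\Pi}_n$ from $T$ if every infinite branch has a tail satisfying all of the following: (a) the tail does not pass through left premisses of $(\mathsf{case})$;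 (b) if the tail passes through the right premiss $\Gamma[z\mapsto s(z)]$ of $(\mathsf{case})$, then after that application the tail does not intersect applications of $(\forall)$ with active variable $z$; (c) for some variable $y$, the tail passes through the right premiss of $(\mathsf{case})$ with active variable $y$ infinitely many times; (d) if the tail passes through the left (right) premiss of $(\wedge)$, then $\varphi$ ($\psi$) is in $\Pi_{n+1}$; (e) if the tail intersects an application of $(\forall)$, then $\varphi[y\mapsto z]\in\Pi_{n+1}$; (f) if the tail passes through the left (right) premiss of $(\mathsf{cut})$, then $\varphi$ ($\overline\varphi$) is in $\Pi_{n+1}$; (g* ) if the tail passes through the right premiss $\Gamma[z\mapsto s(z)]$ of $(\mathsf{case})$, then $\Gamma$ consists entirely of $\Pi_{n+1}$-formulas. Such a tree is regular if it contains only finitely many non-isomorphic subtrees with respect to the marking of sequents. A sequent $\Gamma$ is provable in $\mathsf{S}^{\Pi}_n$ from assumptions $T$ if there is a regular $\infty$-proof of $\mathsf{S}^{\Pi}_n$ from $T$ with root marked by $\Gamma$. *)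

(* Defs.v *)
From HB Require Import structures.
From mathcomp Require Import all_boot.
From mathcomp Require Import finmap multiset.

Set Implicit Arguments.
Unset Strict Implicit.
Unset Printing Implicit Defensive.

Local Open Scope mset_scope.

Inductive term : Type :=
| tVar of nat
| tZero
| tSucc of term
| tAdd of term & term
| tMul of term & term.

Inductive formula : Type :=
| fEq of term & term
| fNeq of term & term
| fAnd of formula & formula
| fOr of formula & formula
| fAll of nat & formula
| fEx of nat & formula.

(* Countability of terms and formulas, needed only so that {mset formula}
   makes sense. *)
Fixpoint term_code (t : term) : GenTree.tree nat :=
  match t with
  | tVar x => GenTree.Leaf x
  | tZero => GenTree.Node 0 [::]
  | tSucc t1 => GenTree.Node 1 [:: term_code t1]
  | tAdd t1 t2 => GenTree.Node 2 [:: term_code t1; term_code t2]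
  | tMul t1 t2 => GenTree.Node 3 [:: term_code t1; term_code t2]
  end.

Fixpoint term_decode (c : GenTree.tree nat) : term :=
  match c with
  | GenTree.Leaf x => tVar x
  | GenTree.Node 1 [:: c1] => tSucc (term_decode c1)
  | GenTree.Node 2 [:: c1; c2] => tAdd (term_decode c1) (term_decode c2)
  | GenTree.Node 3 [:: c1; c2] => tMul (term_decode c1) (term_decode c2)
  | _ => tZero
  end.

Lemma term_codeK : cancel term_code term_decode.
Proof.
by elim=> [x||t IHt|t IHt u IHu|t IHt u IHu] //=; rewrite ?IHt ?IHu.
Qed.

HB.instance Definition _ := Countable.copy term (can_type term_codeK).

Fixpoint formula_code (A : formula) : GenTree.tree (nat + term) :=
  match A with
  | fEq t u => GenTree.Node 0 [:: GenTree.Leaf (inr t); GenTree.Leaf (inr u)]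
  | fNeq t u => GenTree.Node 1 [:: GenTree.Leaf (inr t); GenTree.Leaf (inr u)]
  | fAnd A1 A2 => GenTree.Node 2 [:: formula_code A1; formula_code A2]
  | fOr A1 A2 => GenTree.Node 3 [:: formula_code A1; formula_code A2]
  | fAll y A1 => GenTree.Node 4 [:: GenTree.Leaf (inl y); formula_code A1]
  | fEx y A1 => GenTree.Node 5 [:: GenTree.Leaf (inl y); formula_code A1]
  end.

Fixpoint formula_decode (c : GenTree.tree (nat + term)) : formula :=
  match c with
  | GenTree.Node 0 [:: GenTree.Leaf (inr t); GenTree.Leaf (inr u)] => fEq t u
  | GenTree.Node 1 [:: GenTree.Leaf (inr t); GenTree.Leaf (inr u)] => fNeq t u
  | GenTree.Node 2 [:: c1; c2] => fAnd (formula_decode c1) (formula_decode c2)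
  | GenTree.Node 3 [:: c1; c2] => fOr (formula_decode c1) (formula_decode c2)
  | GenTree.Node 4 [:: GenTree.Leaf (inl y); c1] => fAll y (formula_decode c1)
  | GenTree.Node 5 [:: GenTree.Leaf (inl y); c1] => fEx y (formula_decode c1)
  | _ => fEq tZero tZero
  end.

Lemma formula_codeK : cancel formula_code formula_decode.
Proof.
by elim=> [t u|t u|A IHA B IHB|A IHA B IHB|y A IHA|y A IHA] //=;
   rewrite ?IHA ?IHB.
Qed.

HB.instance Definition _ := Countable.copy formula (can_type formula_codeK).

Fixpoint fneg (A : formula) : formula :=
  match A with
  | fEq t u => fNeq t u
  | fNeq t u => fEq t u
  | fAnd A1 A2 => fOr (fneg A1) (fneg A2)
  | fOr A1 A2 => fAnd (fneg A1) (fneg A2)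
  | fAll y A1 => fEx y (fneg A1)
  | fEx y A1 => fAll y (fneg A1)
  end.

Definition fBot : formula := fNeq tZero tZero.
Definition fImp (A B : formula) : formula := fOr (fneg A) B.

(* [fLe z t u] is t <= u, with z as the bound variable; meant for z not
   occurring in t and u. *)
Definition fLe (z : nat) (t u : term) : formula := fEx z (fEq (tAdd (tVar z) t) u).

Fixpoint tfv (t : term) : seq nat :=
  match t with
  | tVar x => [:: x]
  | tZero => [::]
  | tSucc t1 => tfv t1
  | tAdd t1 t2 | tMul t1 t2 => tfv t1 ++ tfv t2
  end.

Fixpoint fv (A : formula) : seq nat :=
  match A with
  | fEq t u | fNeq t u => tfv t ++ tfv u
  | fAnd A1 A2 | fOr A1 A2 => fv A1 ++ fv A2
  | fAll y A1 | fEx y A1 => [seq x <- fv A1 | x != y]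
  end.

Definition sentence (A : formula) : Prop := fv A = [::].

Fixpoint tsubst (y : nat) (t u : term) : term :=
  match u with
  | tVar x => if x == y then t else u
  | tZero => tZero
  | tSucc u1 => tSucc (tsubst y t u1)
  | tAdd u1 u2 => tAdd (tsubst y t u1) (tsubst y t u2)
  | tMul u1 u2 => tMul (tsubst y t u1) (tsubst y t u2)
  end.

(* [subst y t A] is A[y |-> t].  It does not rename bound variables, so it is
   used together with [free_for y t A], which says that no variable of t
   becomes bound. *)
Fixpoint subst (y : nat) (t : term) (A : formula) : formula :=
  match A with
  | fEq u v => fEq (tsubst y t u) (tsubst y t v)
  | fNeq u v => fNeq (tsubst y t u) (tsubst y t v)
  | fAnd A1 A2 => fAnd (subst y t A1) (subst y t A2)
  | fOr A1 A2 => fOr (subst y t A1) (subst y t A2)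
  | fAll x A1 => if x == y then A else fAll x (subst y t A1)
  | fEx x A1 => if x == y then A else fEx x (subst y t A1)
  end.

Fixpoint free_for (y : nat) (t : term) (A : formula) : bool :=
  match A with
  | fEq _ _ | fNeq _ _ => true
  | fAnd A1 A2 | fOr A1 A2 => free_for y t A1 && free_for y t A2
  | fAll x A1 | fEx x A1 =>
      (y \notin fv A) || ((x \notin tfv t) && free_for y t A1)
  end.

Notation sequent := {mset formula}.

Definition fv_sequent (G : sequent) : seq nat := flatten [seq fv A | A <- G].

(* Only used with t = 0 and t = s(y), which are free for y in every formula. *)
Definition subst_sequent (y : nat) (t : term) (G : sequent) : sequent :=
  seq_mset [seq subst y t A | A <- G].

(* The disjunction is taken along the library's enumeration of the multiset. *)
Definition big_or (G : sequent) : formula :=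
  if (G : seq formula) is A :: s then foldl fOr A s else fBot.

Inductive Delta0 : formula -> Prop :=
| Delta0_eq t u : Delta0 (fEq t u)
| Delta0_neq t u : Delta0 (fNeq t u)
| Delta0_and A B : Delta0 A -> Delta0 B -> Delta0 (fAnd A B)
| Delta0_or A B : Delta0 A -> Delta0 B -> Delta0 (fOr A B)
| Delta0_ball y z t A :
    y \notin tfv t -> z \notin tfv t -> z != y ->
    Delta0 A -> Delta0 (fAll y (fImp (fLe z (tVar y) t) A))
| Delta0_bex y z t A :
    y \notin tfv t -> z \notin tfv t -> z != y ->
    Delta0 A -> Delta0 (fEx y (fAnd (fLe z (tVar y) t) A)).

Inductive ex_closure (P : formula -> Prop) : formula -> Prop :=
| ex_closure_base A : P A -> ex_closure P A
| ex_closure_and A B : ex_closure P A -> ex_closure P B -> ex_closure P (fAnd A B)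
| ex_closure_or A B : ex_closure P A -> ex_closure P B -> ex_closure P (fOr A B)
| ex_closure_ex y A : ex_closure P A -> ex_closure P (fEx y A).

Inductive all_closure (P : formula -> Prop) : formula -> Prop :=
| all_closure_base A : P A -> all_closure P A
| all_closure_and A B : all_closure P A -> all_closure P B -> all_closure P (fAnd A B)
| all_closure_or A B : all_closure P A -> all_closure P B -> all_closure P (fOr A B)
| all_closure_all y A : all_closure P A -> all_closure P (fAll y A).

Fixpoint Sigma (n : nat) : formula -> Prop :=
  if n is m.+1 then ex_closure (Pi m) else Delta0
with Pi (n : nat) : formula -> Prop :=
  if n is m.+1 then all_closure (Sigma m) else Delta0.

Definition Q_axioms : seq formula :=
  let x := tVar 0 in
  let y := tVar 1 in
  [:: fAll 0 (fneg (fEq (tSucc x) tZero));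
      fAll 0 (fAll 1 (fImp (fEq (tSucc x) (tSucc y)) (fEq x y)));
      fAll 0 (fOr (fEq x tZero) (fEx 1 (fEq x (tSucc y))));
      fAll 0 (fEq (tAdd x tZero) x);
      fAll 0 (fAll 1 (fEq (tAdd x (tSucc y)) (tSucc (tAdd x y))));
      fAll 0 (fEq (tMul x tZero) tZero);
      fAll 0 (fAll 1 (fEq (tMul x (tSucc y)) (tAdd (tMul x y) x)))].

Definition Q_plus (T : formula -> Prop) (A : formula) : Prop :=
  A \in Q_axioms \/ T A.

(* Finite derivations in first-order logic with equality (one-sided sequent
   calculus with cut), from the axioms in U, with the rule (IR) for formulas
   in C.  Axioms and (IR) carry no side formulas: (IR) is a rule, not the
   induction schema.  Contraction is derivable using [pr_cut] and [pr_id]. *)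
Inductive derivable (U C : formula -> Prop) : sequent -> Prop :=
| pr_id G A : derivable U C (A +` (fneg A +` G))
| pr_refl G t : derivable U C (fEq t t +` G)
| pr_leibniz G A y t u :
    free_for y t A -> free_for y u A ->
    derivable U C (fNeq t u +` (fneg (subst y t A) +` (subst y u A +` G)))
| pr_and G A B :
    derivable U C (A +` G) -> derivable U C (B +` G) ->
    derivable U C (fAnd A B +` G)
| pr_or G A B : derivable U C (A +` (B +` G)) -> derivable U C (fOr A B +` G)
| pr_all G y A z :
    free_for y (tVar z) A -> z \notin fv_sequent (fAll y A +` G) ->
    derivable U C (subst y (tVar z) A +` G) -> derivable U C (fAll y A +` G)
| pr_ex G y A t :
    free_for y t A ->
    derivable U C (subst y t A +` (fEx y A +` G)) -> derivable U C (fEx y A +` G)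
| pr_weak G D : derivable U C G -> derivable U C (G `+` D)
| pr_cut G A :
    derivable U C (A +` G) -> derivable U C (fneg A +` G) -> derivable U C G
| pr_axiom A : U A -> derivable U C [mset A]
| pr_IR x A :
    C A ->
    derivable U C [mset subst x tZero A] ->
    derivable U C [mset fAll x (fImp A (subst x (tSucc (tVar x)) A))] ->
    derivable U C [mset fAll x A].

Definition theorem_of_Pi_IR (U : formula -> Prop) (m : nat) (A : formula) : Prop :=
  derivable U (Pi m) [mset A].

(* An application of an initial sequent, an assumption or a rule of SQ,
   together with all its parameters. *)
Inductive inference : Type :=
| iAxEq of sequent & term & term
| iAxSucc of sequent & term
| iAssumption of formula
| iAnd of sequent & formula & formula
| iOr of sequent & formula & formula
| iAll of sequent & nat & formula & nat
| iEx of sequent & nat & formula & term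
| iRef of sequent & term
| iRep of sequent & term & term & nat & term & term
| iAdd0 of sequent & term
| iAddS of sequent & term & term
| iMul0 of sequent & term
| iMulS of sequent & term & term
| iPred of sequent & term & term
| iCase of sequent & nat
| iWeak of sequent & sequent
| iCut of sequent & formula.

Definition conclusion (r : inference) : sequent :=
  match r with
  | iAxEq G t0 t1 => fEq t0 t1 +` (fNeq t0 t1 +` G)
  | iAxSucc G t => fNeq (tSucc t) tZero +` G
  | iAssumption A => [mset A]
  | iAnd G A B => fAnd A B +` G
  | iOr G A B => fOr A B +` G
  | iAll G y A z => fAll y A +` G
  | iEx G y A t => fEx y A +` G
  | iRef G t => G
  | iRep G t0 t1 y u0 u1 => fNeq t0 t1 +` (subst y t0 (fNeq u0 u1) +` G)
  | iAdd0 G t => G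
  | iAddS G t u => G
  | iMul0 G t => G
  | iMulS G t u => G
  | iPred G t0 t1 => fNeq (tSucc t0) (tSucc t1) +` G
  | iCase G y => G
  | iWeak G D => G `+` D
  | iCut G A => G
  end.

(* [premiss r false] is the left (or the only) premiss, [premiss r true] the
   right one. *)
Definition premiss (r : inference) (b : bool) : option sequent :=
  let unary G := if b then None else Some G in
  let binary G0 G1 := Some (if b then G1 else G0) in
  match r with
  | iAxEq _ _ _ | iAxSucc _ _ | iAssumption _ => None
  | iAnd G A B => binary (A +` G) (B +` G)
  | iOr G A B => unary (A +` (B +` G))
  | iAll G y A z => unary (subst y (tVar z) A +` G)
  | iEx G y A t => unary (subst y t A +` (fEx y A +` G))
  | iRef G t => unary (fNeq t t +` G)
  | iRep G t0 t1 y u0 u1 =>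
      unary (fNeq t0 t1 +` (subst y t0 (fNeq u0 u1) +`
             (subst y t1 (fNeq u0 u1) +` G)))
  | iAdd0 G t => unary (fNeq (tAdd t tZero) t +` G)
  | iAddS G t u => unary (fNeq (tAdd t (tSucc u)) (tSucc (tAdd t u)) +` G)
  | iMul0 G t => unary (fNeq (tMul t tZero) tZero +` G)
  | iMulS G t u => unary (fNeq (tMul t (tSucc u)) (tAdd (tMul t u) t) +` G)
  | iPred G t0 t1 =>
      unary (fNeq (tSucc t0) (tSucc t1) +` (fNeq t0 t1 +` G))
  | iCase G y =>
      binary (subst_sequent y tZero G) (subst_sequent y (tSucc (tVar y)) G)
  | iWeak G D => unary G
  | iCut G A => binary (A +` G) (fneg A +` G)
  end.

Definition side_condition (T : formula -> Prop) (r : inference) : Prop :=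
  match r with
  | iAssumption A => T A
  | iAll G y A z => free_for y (tVar z) A /\ z \notin fv_sequent (fAll y A +` G)
  | iEx G y A t => free_for y t A
  | iCase G y => y \in fv_sequent G
  | _ => True
  end.

(* A possibly infinite tree of inferences, given on addresses: the root is
   [::], and [rcons p b] is the child of p for the premiss b.  Addresses
   outside the tree are mapped to None. *)
Definition inference_tree : Type := seq bool -> option inference.

Definition marking (t : inference_tree) (p : seq bool) : option sequent :=
  omap conclusion (t p).

Definition locally_correct (T : formula -> Prop) (t : inference_tree) : Prop :=
  forall p : seq bool,
    if t p is Some r then
      side_condition T r /\ forall b, marking t (rcons p b) = premiss r b
    else forall b, t (rcons p b) = None.

(* A branch is a sequence of directions; its k-th node is [mkseq beta k]. *)
Definition infinite_branch (t : inference_tree) (beta : nat -> bool) : Prop :=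
  forall k, isSome (t (mkseq beta k)).

(* Conditions on the tail of the branch beta that starts at its N-th node; the
   tail passes through the premiss [beta k] of the inference at its k-th node. *)
Record good_tail (n : nat) (t : inference_tree) (beta : nat -> bool) (N : nat) :
    Prop := GoodTail {
  tail_a : forall k G y, N <= k ->
    t (mkseq beta k) = Some (iCase G y) -> beta k = true;
  tail_b : forall k G z, N <= k ->
    t (mkseq beta k) = Some (iCase G z) -> beta k = true ->
    forall j G' y A z', k < j ->
      t (mkseq beta j) = Some (iAll G' y A z') -> z' <> z;
  tail_c : exists y, forall m, exists k G,
    [/\ N <= k, m <= k, t (mkseq beta k) = Some (iCase G y) & beta k = true];
  tail_d : forall k G A B, N <= k ->
    t (mkseq beta k) = Some (iAnd G A B) -> Pi n.+1 (if beta k then B else A);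
  tail_e : forall k G y A z, N <= k ->
    t (mkseq beta k) = Some (iAll G y A z) -> Pi n.+1 (subst y (tVar z) A);
  tail_f : forall k G A, N <= k ->
    t (mkseq beta k) = Some (iCut G A) -> Pi n.+1 (if beta k then fneg A else A);
  tail_g : forall k G z, N <= k ->
    t (mkseq beta k) = Some (iCase G z) -> beta k = true ->
    forall A, A \in G -> Pi n.+1 A
}.

Definition infinity_proof (n : nat) (T : formula -> Prop) (t : inference_tree) :
    Prop :=
  locally_correct T t /\
  forall beta, infinite_branch t beta -> exists N, good_tail n t beta N.

(* Subtrees are compared as ordered trees marked by sequents; the rule
   annotations are ignored. *)
Definition regular (t : inference_tree) : Prop :=
  exists s : seq (seq bool), forall p, isSome (t p) ->
    exists2 q, q \in s & forall w, marking t (p ++ w) = marking t (q ++ w).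

Definition S_Pi_provable (n : nat) (T : formula -> Prop) (G : sequent) : Prop :=
  exists t : inference_tree,
    [/\ infinity_proof n T t, regular t & marking t [::] = Some G].

(* Main.v *)
Require Import Defs.
From mathcomp Require Import all_boot.
From mathcomp Require Import finmap multiset.
From mathcomp Require Import zify.
From mathcomp Require Import boolp.

(** Suppose that some node of the regular proof tree is marked by an
    underivable sequent; call such nodes bad.  Every bad node has a bad child,
    and by regularity there is a bad node p0 that can be reached again, up to
    bisimilarity, from every node of the set B of nodes accessible from it
    through bad nodes.  By looping in B one obtains infinite branches through
    any given edges of B, so on B the conditions on tails say: the left premiss
    of a (case) is not bad, its conclusion consists of Pi_{n+1}-formulas, and
    its active variable is not the active variable of a (forall).  Hence, with S
    the sum of the variables on which (case) is applied in B, S decreases by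
    one at every (case) and is constant elsewhere, and the formula
      forall xs, S <> N \/ (conjunction of the conclusions of (case) in B)
    is provable by one application of the Pi_{n+1}-induction rule on N: the
    left premisses of (case) are not bad, and going up from a right premiss one
    meets the induction hypothesis, since a branch of B without (case) is
    impossible.  So p0 is derivable after all.

    Regularity ignores the names of the inferences, but (case) and the
    non-vacuous (forall), with their active variables, can be read off the
    sequents. *)

Set Implicit Arguments.
Unset Strict Implicit.
Unset Printing Implicit Defensive.

Local Open Scope mset_scope.

(** * Substitution and derivations *)

Lemma fv_fneg A : fv (fneg A) = fv A.
Proof. by elim: A => //= [A -> B ->|A -> B ->|y A ->|y A ->]. Qed.

Lemma subst_fneg y t A : subst y t (fneg A) = fneg (subst y t A).
Proof.
elim: A => //= [A -> B ->|A -> B ->|x A IH|x A IH] //.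
  by case: ifP => //= _; rewrite IH.
by case: ifP => //= _; rewrite IH.
Qed.

Lemma free_for_fneg y t A : free_for y t (fneg A) = free_for y t A.
Proof. by elim: A => //= [A -> B ->|A -> B ->|x A ->|x A ->]; rewrite ?fv_fneg. Qed.

Lemma tsubst_id y u : tsubst y (tVar y) u = u.
Proof.
by elim: u => //= [x|u ->|u -> v ->|u -> v ->] //; case: eqP => // ->.
Qed.

Lemma subst_id y A : subst y (tVar y) A = A.
Proof.
by elim: A => //= [t u|t u|A -> B ->|A -> B ->|x A ->|x A ->] //;
   rewrite ?tsubst_id ?if_same.
Qed.

Lemma free_for_id y A : free_for y (tVar y) A.
Proof.
elim: A => //= [A -> B ->|A -> B ->|x A ->|x A ->] //;
  by rewrite mem_filter inE andbT (eq_sym x); case: (y == x) => //=; rewrite orbT.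
Qed.

Lemma tsubst_fresh y t u : y \notin tfv u -> tsubst y t u = u.
Proof.
elim: u => //= [x|u IH|u IHu v IHv|u IHu v IHv]; rewrite ?mem_cat ?inE ?negb_or.
- by rewrite eq_sym => /negbTE ->.
- by move=> ?; rewrite IH.
- by move=> /andP[? ?]; rewrite IHu ?IHv.
- by move=> /andP[? ?]; rewrite IHu ?IHv.
Qed.

Lemma subst_fresh y t A : y \notin fv A -> subst y t A = A.
Proof.
elim: A => //= [u v|u v|A IHA B IHB|A IHA B IHB|x A IH|x A IH];
  rewrite ?mem_cat ?negb_or ?mem_filter.
- by move=> /andP[? ?]; rewrite !tsubst_fresh.
- by move=> /andP[? ?]; rewrite !tsubst_fresh.
- by move=> /andP[? ?]; rewrite IHA ?IHB.
- by move=> /andP[? ?]; rewrite IHA ?IHB.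
- by rewrite (eq_sym x); case: eqP => //= _ ?; rewrite IH.
- by rewrite (eq_sym x); case: eqP => //= _ ?; rewrite IH.
Qed.

Lemma mem_tfv_tsubst x y t u :
  (x \in tfv (tsubst y t u)) =
  (x != y) && (x \in tfv u) || (y \in tfv u) && (x \in tfv t).
Proof.
elim: u => //= [v||u IHu v IHv|u IHu v IHv]; rewrite ?mem_cat ?IHu ?IHv ?inE.
- case: (eqVneq v y) => [->|nvy] /=; rewrite ?inE ?eqxx /=.
    by case: (x == y).
  by rewrite orbF; have [->|] := eqVneq x v; rewrite ?nvy ?andbF.
- by rewrite andbF.
- by case: (x == y); case: (x \in tfv u); case: (y \in tfv u);
     case: (x \in tfv t); case: (x \in tfv v); case: (y \in tfv v).
- by case: (x == y); case: (x \in tfv u); case: (y \in tfv u);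
     case: (x \in tfv t); case: (x \in tfv v); case: (y \in tfv v).
Qed.

Lemma mem_fv_subst x y t A : free_for y t A ->
  (x \in fv (subst y t A)) =
  (x != y) && (x \in fv A) || (y \in fv A) && (x \in tfv t).
Proof.
have bin (C D : formula) :
    (x \in fv (subst y t C)) =
      (x != y) && (x \in fv C) || (y \in fv C) && (x \in tfv t) ->
    (x \in fv (subst y t D)) =
      (x != y) && (x \in fv D) || (y \in fv D) && (x \in tfv t) ->
    (x \in fv (subst y t C) ++ fv (subst y t D)) =
      (x != y) && (x \in fv C ++ fv D) || (y \in fv C ++ fv D) && (x \in tfv t).
  rewrite !mem_cat => -> ->.
  by case: (x == y); case: (x \in fv C); case: (y \in fv C);
     case: (x \in tfv t); case: (x \in fv D); case: (y \in fv D).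
(* [fAll] and [fEx] have the same free variables, so one statement serves both quantifiers. *)
have quant z C :
    (free_for y t C -> (x \in fv (subst y t C)) =
      (x != y) && (x \in fv C) || (y \in fv C) && (x \in tfv t)) ->
    (y \notin [seq v <- fv C | v != z]) || (z \notin tfv t) && free_for y t C ->
    (x \in fv (if z == y then fAll z C else fAll z (subst y t C))) =
    (x != y) && (x \in [seq v <- fv C | v != z]) ||
      (y \in [seq v <- fv C | v != z]) && (x \in tfv t).
  move=> IH; have [->|nzy] /= := eqVneq z y.
    by rewrite !mem_filter eqxx /= orbF andbA andbb.
  have [yC|yC] /= := boolP (y \in [seq v <- fv C | v != z]).
    move=> /andP[zt /IH]; rewrite !mem_filter => ->.
    move: yC; rewrite mem_filter eq_sym nzy /= => ->.
    have [->|_] := eqVneq x z; first by rewrite (negbTE zt) /= andbF.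
    by case: (x != y).
  move=> _; rewrite subst_fresh ?orbF; last first.
    by move: yC; rewrite mem_filter eq_sym nzy.
  by have [->|//] := eqVneq x y; rewrite (negbTE yC).
have atom (u v : term) :
    (x \in tfv (tsubst y t u) ++ tfv (tsubst y t v)) =
      (x != y) && (x \in tfv u ++ tfv v) || (y \in tfv u ++ tfv v) && (x \in tfv t).
  rewrite !mem_cat !mem_tfv_tsubst.
  by case: (x == y); case: (x \in tfv u); case: (y \in tfv u);
     case: (x \in tfv t); case: (x \in tfv v); case: (y \in tfv v).
elim: A => [u v|u v|C IHC D IHD|C IHC D IHD|z C IH|z C IH] /=.
- by move=> _; apply: atom.
- by move=> _; apply: atom.
- by move=> /andP[/IHC ? /IHD ?]; apply: bin.
- by move=> /andP[/IHC ? /IHD ?]; apply: bin.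
- exact: quant.
- by move=> /(quant _ _ IH); case: ifP.
Qed.

Lemma notin_fv_all y A : y \notin fv (fAll y A).
Proof. by rewrite /= mem_filter eqxx. Qed.

(** Since [subst] does not rename, a variable outside [bv A] is a safe choice for a fresh one; [bv]
    is unchanged by substitution, so the choice stays safe after further substitutions. *)
Fixpoint bv (A : formula) : seq nat :=
  match A with
  | fEq _ _ | fNeq _ _ => [::]
  | fAnd A1 A2 | fOr A1 A2 => bv A1 ++ bv A2
  | fAll y A1 | fEx y A1 => y :: bv A1
  end.

Lemma bv_subst y t A : bv (subst y t A) = bv A.
Proof.
by elim: A => //= [A -> B ->|A -> B ->|x A IH|x A IH] //; case: ifP => //= _; rewrite IH.
Qed.

Lemma free_for_bv y t A : {in tfv t, forall x, x \notin bv A} -> free_for y t A.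
Proof.
elim: A => //= [A IHA B IHB|A IHA B IHB|x A IH|x A IH] h.
- by rewrite IHA ?IHB // => x /h; rewrite mem_cat negb_or => /andP[].
- by rewrite IHA ?IHB // => x /h; rewrite mem_cat negb_or => /andP[].
- rewrite IH ?andbT; last by move=> z /h; rewrite inE negb_or => /andP[].
  by apply/orP; right; apply/negP => /h; rewrite inE eqxx.
- rewrite IH ?andbT; last by move=> z /h; rewrite inE negb_or => /andP[].
  by apply/orP; right; apply/negP => /h; rewrite inE eqxx.
Qed.

(** Covers the two substitutions made by (case), by $0$ and by $s(y)$: a binder other than [y]
    captures nothing, and below a binder [y] there is nothing to replace. *)
Lemma free_for_same_var y t A : {subset tfv t <= [:: y]} -> free_for y t A.
Proof.
move=> h; elim: A => //= [A -> B ->|A -> B ->|x A ->|x A ->] //;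
  rewrite mem_filter andbT; have [->|nyx] //= := eqVneq y x;
  by apply/orP; right; apply/negP => /h; rewrite inE eq_sym (negbTE nyx).
Qed.

Lemma tsubst_var x y v w :
  y \notin tfv w -> tsubst y v (tsubst x (tVar y) w) = tsubst x v w.
Proof.
elim: w => //= [z|w1 IH|w1 IH1 w2 IH2|w1 IH1 w2 IH2];
  rewrite ?mem_cat ?inE ?negb_or.
- by case: (z == x) => /=; rewrite ?eqxx // eq_sym => /negbTE ->.
- by move=> ?; rewrite IH.
- by move=> /andP[? ?]; rewrite IH1 ?IH2.
- by move=> /andP[? ?]; rewrite IH1 ?IH2.
Qed.

Lemma tsubst_succ_var z y u :
  tsubst z (tVar y) (tsubst z (tSucc (tVar z)) u) = tsubst z (tSucc (tVar y)) u.
Proof.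
elim: u => //= [x|u ->|u -> v ->|u -> v ->] //.
by have [_|nxz] := eqVneq x z; rewrite /= ?eqxx // (negbTE nxz).
Qed.

Lemma subst_succ_var z y A :
  subst z (tVar y) (subst z (tSucc (tVar z)) A) = subst z (tSucc (tVar y)) A.
Proof.
elim: A => //= [u v|u v|A -> B ->|A -> B ->|x A IH|x A IH] //;
  rewrite ?tsubst_succ_var //.
  by case: ifP => nxz /=; rewrite nxz // IH.
by case: ifP => nxz /=; rewrite nxz // IH.
Qed.

(** * Fresh variables; finite disjunctions, conjunctions and universal closures *)

Definition fresh (l : seq nat) : nat := (\max_(x <- l) x).+1.

Lemma fresh_notin l : fresh l \notin l.
Proof.
apply/negP => h; suff: fresh l <= \max_(x <- l) x by rewrite ltnn.
by rewrite (big_rem _ h) /= leq_maxl.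
Qed.

Definition fvs (l : seq formula) : seq nat := flatten [seq fv A | A <- l].

Lemma fvs_cons A l : fvs (A :: l) = fv A ++ fvs l. Proof. by []. Qed.

Lemma fvs_cat l k : fvs (l ++ k) = fvs l ++ fvs k.
Proof. by rewrite /fvs map_cat flatten_cat. Qed.

(** Nested to the right and closed by [fBot], which suits induction on lists better than the
    left-nested [big_or]. *)
Definition ors (l : seq formula) : formula := foldr fOr fBot l.

Lemma subst_ors y t l : subst y t (ors l) = ors [seq subst y t A | A <- l].
Proof. by elim: l => //= A l ->. Qed.

Definition ands (l : seq formula) : formula := foldr fAnd (fEq tZero tZero) l.

Definition alls (xs : seq nat) (A : formula) : formula := foldr fAll A xs.

Lemma mem_fv_alls x xs A : (x \in fv (alls xs A)) = (x \in fv A) && (x \notin xs).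
Proof.
elim: xs => [|y xs IH] /=; first by rewrite andbT.
by rewrite mem_filter IH inE negb_or; case: (x == y); rewrite ?andbF.
Qed.

Lemma subst_alls y t xs A : y \notin xs -> subst y t (alls xs A) = alls xs (subst y t A).
Proof.
elim: xs => //= x xs IH; rewrite inE negb_or eq_sym => /andP[/negbTE -> /IH ->] //.
Qed.

(** * Inclusions between lists *)

Section Inclusions.

Variable T : eqType.
Implicit Types (a x : T) (l k : seq T).

Lemma mem_consr a x l : x \in l -> x \in a :: l.
Proof. by rewrite inE => ->; rewrite orbT. Qed.

Lemma mem_catl x l k : x \in l -> x \in l ++ k.
Proof. by rewrite mem_cat => ->. Qed.

Lemma mem_catr x l k : x \in k -> x \in l ++ k.
Proof. by rewrite mem_cat => ->; rewrite orbT. Qed.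

Lemma sub_nil k : {subset [::] <= k}. Proof. by []. Qed.

Lemma sub_refl k : {subset k <= k}. Proof. by []. Qed.

Lemma sub_consl a l k : a \in k -> {subset l <= k} -> {subset a :: l <= k}.
Proof. by move=> ak lk x; rewrite inE => /orP[/eqP->|/lk]. Qed.

Lemma sub_catl l l' k : {subset l <= k} -> {subset l' <= k} -> {subset l ++ l' <= k}.
Proof. by move=> lk lk' x; rewrite mem_cat => /orP[/lk|/lk']. Qed.

Lemma sub_consr a l k : {subset l <= k} -> {subset l <= a :: k}.
Proof. by move=> lk x /lk; apply: mem_consr. Qed.

Lemma sub_catr1 l k k' : {subset l <= k} -> {subset l <= k ++ k'}.
Proof. by move=> lk x /lk; apply: mem_catl. Qed.

Lemma sub_catr2 l k k' : {subset l <= k'} -> {subset l <= k ++ k'}.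
Proof. by move=> lk x /lk; apply: mem_catr. Qed.

End Inclusions.

(* Rewriting with [inE] compares formulas up to conversion of their countable
   encodings, which is prohibitively slow; these tactics only compare them
   syntactically. *)
Ltac mem_tac_rec :=
  first [ assumption
        | match goal with |- is_true (?a \in ?a :: _) => apply: mem_head end
        | apply: mem_consr; mem_tac_rec
        | apply: mem_catl; mem_tac_rec
        | apply: mem_catr; mem_tac_rec ].

Ltac mem_tac := simpl; mem_tac_rec.

Ltac sub_tac_rec :=
  match goal with
  | |- {subset [::] <= _} => apply: sub_nil
  | |- {subset _ :: _ <= _} => apply: sub_consl; [mem_tac_rec | sub_tac_rec]
  | |- {subset _ ++ _ <= _} => apply: sub_catl; sub_tac_rec
  | |- {subset ?l <= ?l} => apply: sub_refl
  | |- {subset _ <= _ :: _} => apply: sub_consr; sub_tac_rec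
  | |- {subset _ <= _ ++ _} =>
      first [ apply: sub_catr1; sub_tac_rec | apply: sub_catr2; sub_tac_rec ]
  end.

Ltac sub_tac := simpl; sub_tac_rec.

(** * Derived rules of the finite calculus *)

Section Derivations.

Variables U C : formula -> Prop.

(** Sequents are handled as lists, so that rules act on the head; by [der_sub] only the set of
    members matters. *)
Definition der (l : seq formula) : Prop := derivable U C (seq_mset l).

(** Cut on [A]: the other premiss contains both [A] and its negation. *)
Lemma derivable_contract A (G : sequent) :
  A \in G -> derivable U C (A +` G) -> derivable U C G.
Proof.
move=> AG d; apply: (pr_cut d).
rewrite -(msetB1K AG) msetDCA; exact: pr_id.
Qed.

(** Weaken by [G'], then contract away the members of [G] one at a time. *)
Lemma derivable_sub (G G' : sequent) :
  {subset G <= G'} -> derivable U C G -> derivable U C G'.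
Proof.
move=> sub /(pr_weak G'); rewrite -{1}(seq_mset_id G).
have: {subset (G : seq formula) <= G'} by [].
elim: (G : seq formula) => [|A s IH] h.
  by rewrite (_ : seq_mset [::] = mset0) ?mset0D //; apply/msetP => B;
     rewrite mset_seqE mset0E.
rewrite mset_cons -msetDA => d; apply: IH.
  by move=> B Bs; apply: h; rewrite inE Bs orbT.
apply: derivable_contract d; rewrite in_msetD (h A) ?orbT ?mem_head //.
Qed.

Lemma mem_seq_mset (l : seq formula) A : (A \in seq_mset l) = (A \in l).
Proof. exact: (perm_mem (perm_eq_seq_mset l)). Qed.

Lemma der_sub l k : {subset l <= k} -> der l -> der k.
Proof. by move=> h; apply: derivable_sub => A; rewrite !mem_seq_mset => /h. Qed.

Lemma der_mset (G : sequent) : der G <-> derivable U C G.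
Proof. by rewrite /der seq_mset_id. Qed.

Lemma seq_mset1 A : seq_mset [:: A] = [mset A] :> sequent.
Proof. by apply/msetP => B; rewrite mset_seqE msetnE /= eq_sym addn0; case: eqP. Qed.

Lemma mem_fv_sequent (G : sequent) l x :
  G =i l -> (x \in fv_sequent G) = (x \in fvs l).
Proof.
move=> h; apply/flatten_mapP/flatten_mapP => -[A AG xA]; exists A => //.
  by rewrite -h.
by move: AG; rewrite -h.
Qed.

Lemma der_id A l : A \in l -> fneg A \in l -> der l.
Proof.
move=> h h'; apply: (@der_sub [:: A, fneg A & l]).
  by move=> B; rewrite !inE => /or3P[/eqP->|/eqP->|].
by rewrite /der !mset_cons; apply: pr_id.
Qed.

Lemma der_refl t l : fEq t t \in l -> der l.
Proof.
move=> h; apply: (@der_sub (fEq t t :: l)).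
  by move=> B; rewrite !inE => /orP[/eqP->|].
by rewrite /der !mset_cons; apply: pr_refl.
Qed.

Lemma der_cut A l : der (A :: l) -> der (fneg A :: l) -> der l.
Proof. by rewrite /der !mset_cons; apply: pr_cut. Qed.

Lemma der_leibniz A y t u l : free_for y t A -> free_for y u A ->
  der (subst y t A :: l) -> der (subst y u A :: fNeq t u :: l).
Proof.
move=> h h' d.
apply: (@der_cut (subst y t A)).
  by apply: der_sub d; sub_tac.
apply: (@der_sub [:: fNeq t u, fneg (subst y t A), subst y u A & l]).
  by sub_tac.
by rewrite /der !mset_cons; apply: pr_leibniz.
Qed.

Lemma der_and A B l : der (A :: l) -> der (B :: l) -> der (fAnd A B :: l).
Proof. by rewrite /der !mset_cons; apply: pr_and. Qed.

Lemma der_or A B l : der (A :: B :: l) -> der (fOr A B :: l).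
Proof. by rewrite /der !mset_cons; apply: pr_or. Qed.

Lemma der_all y A z l : free_for y (tVar z) A -> z \notin fvs (fAll y A :: l) ->
  der (subst y (tVar z) A :: l) -> der (fAll y A :: l).
Proof.
rewrite /der !mset_cons => h zl; apply: pr_all => //.
by rewrite (@mem_fv_sequent _ (fAll y A :: l)) // => B; rewrite -mset_cons mem_seq_mset.
Qed.

Lemma der_ex y A t l : free_for y t A ->
  der (subst y t A :: fEx y A :: l) -> der (fEx y A :: l).
Proof. by rewrite /der !mset_cons; apply: pr_ex. Qed.

Lemma der_axiom A l : U A -> A \in l -> der l.
Proof.
move=> UA Al; apply: (@der_sub [:: A]); first by move=> B; rewrite inE => /eqP ->.
by rewrite /der seq_mset1; apply: pr_axiom.
Qed.

(** The induction step may be given as an open sequent: as it has no further side formulas, [x] can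
    be generalised. *)
Lemma der_IR x A : C A -> der [:: subst x tZero A] ->
  der [:: fneg A; subst x (tSucc (tVar x)) A] -> der [:: fAll x A].
Proof.
move=> CA d0 dS; rewrite /der seq_mset1; apply: pr_IR => //.
  by rewrite -seq_mset1.
rewrite -seq_mset1; apply: (@der_all _ _ x).
- exact: free_for_id.
- by rewrite fvs_cons mem_cat (negbTE (notin_fv_all _ _)).
- by rewrite subst_id; apply: der_or; apply: der_sub dS; sub_tac.
Qed.

Lemma der_all_elim y A t l : free_for y t A ->
  der (fAll y A :: l) -> der (subst y t A :: l).
Proof.
move=> h d; apply: (@der_cut (fAll y A)); first by apply: der_sub d; sub_tac.
apply: (@der_ex _ _ t) => [|{d}].
  by rewrite free_for_fneg.
by apply: (@der_id (subst y t A)); rewrite ?subst_fneg; mem_tac.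
Qed.

Lemma der_or_elim A B l : der (fOr A B :: l) -> der (A :: B :: l).
Proof.
move=> d; apply: (@der_cut (fOr A B)); first by apply: der_sub d; sub_tac.
rewrite /=; apply: der_and.
  by apply: (@der_id A); mem_tac.
by apply: (@der_id B); mem_tac.
Qed.

Lemma der_bot l : der (fBot :: l) -> der l.
Proof.
move=> d; apply: (der_cut d); apply: (@der_refl tZero); exact: mem_head.
Qed.

Lemma der_ors l k : der (ors l :: k) <-> der (l ++ k).
Proof.
split.
  elim: l k => [|A l IH] k /=; first exact: der_bot.
  move=> /der_or_elim d; apply: (@der_sub (l ++ A :: k)); first by sub_tac.
  by apply: IH; apply: der_sub d; sub_tac.
elim: l k => [|A l IH] k /= d; first by apply: der_sub d; sub_tac.
apply: der_or; apply: (@der_sub (ors l :: A :: k)); first by sub_tac.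
by apply: IH; apply: der_sub d; sub_tac.
Qed.

Lemma der_ands l k : {in l, forall A, der (A :: k)} -> der (ands l :: k).
Proof.
elim: l => [|A l IH] h /=; first by apply: (@der_refl tZero); exact: mem_head.
apply: der_and; first by apply: h; exact: mem_head.
by apply: IH => B Bl; apply: h; rewrite inE Bl orbT.
Qed.

Lemma der_ands_elim l k A : A \in l -> der (fneg (ands l) :: A :: k).
Proof.
elim: l => //= B l IH; rewrite inE => /orP[/eqP->|/IH d]; apply: der_or.
  by apply: (@der_id B); mem_tac.
by apply: der_sub d; sub_tac.
Qed.

Lemma der_alls xs A l : {in xs, forall x, x \notin fvs l} ->
  der (A :: l) -> der (alls xs A :: l).
Proof.
elim: xs => //= x xs IH h d; apply: (@der_all _ _ x).
- exact: free_for_id.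
- by rewrite fvs_cons mem_cat (negbTE (notin_fv_all _ _)) /=; apply: h; exact: mem_head.
- by rewrite subst_id; apply: IH => // z zxs; apply: h; rewrite inE zxs orbT.
Qed.

Lemma der_alls_elim xs A l : A \in l -> der (fneg (alls xs A) :: l).
Proof.
move=> Al; elim: xs => [|x xs IH] /=.
  by apply: (@der_id A); mem_tac.
apply: (@der_ex _ _ (tVar x)); first exact: free_for_id.
by rewrite subst_id; apply: der_sub IH; sub_tac.
Qed.

(** The disjunction of the list is generalised over [y] and then instantiated by [t], instead of
    transforming the derivation. *)
Lemma der_subst y t l : {in l, forall A, free_for y t A} -> der l ->
  der [seq subst y t A | A <- l].
Proof.
move=> ff d; suff: der (subst y t (ors l) :: [::]).
  by rewrite subst_ors => /der_ors; rewrite cats0.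
apply: der_all_elim.
  elim: l ff {d} => //= A l IH h; rewrite h ?mem_head // IH // => B Bl.
  by apply: h; rewrite inE Bl orbT.
apply: (@der_all _ _ y); first exact: free_for_id.
  by rewrite fvs_cons mem_cat (negbTE (notin_fv_all _ _)).
by rewrite subst_id; apply/der_ors; rewrite cats0.
Qed.

(** Leibniz for the formula $x=t$ with $x$ fresh, starting from $t=t$. *)
Lemma der_eq_sym t u l : der (fEq t u :: l) -> der (fEq u t :: l).
Proof.
move=> d; pose x := fresh (tfv t).
have e v : tsubst x v t = t by apply: tsubst_fresh; apply: fresh_notin.
apply: (der_cut (A := fEq t u)); first by apply: der_sub d; sub_tac.
have := @der_leibniz (fEq (tVar x) t) x t u l isT isT.
rewrite /= eqxx !e => h.
apply: (@der_sub [:: fEq u t, fNeq t u & l]); first by sub_tac.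
by apply: h; apply: (@der_refl t); exact: mem_head.
Qed.

Lemma der_eq_subst A y t u l : free_for y t A -> free_for y u A ->
  der (fEq t u :: l) -> der (subst y t A :: l) -> der (subst y u A :: l).
Proof.
move=> h h' dtu d; apply: (der_cut (A := fEq t u)).
  by apply: der_sub dtu; sub_tac.
by apply: der_sub (der_leibniz h h' d); sub_tac.
Qed.

Lemma der_eq_trans u t v l : der (fEq t u :: l) -> der (fEq u v :: l) ->
  der (fEq t v :: l).
Proof.
move=> dtu duv; pose x := fresh (tfv t).
have e w : tsubst x w t = t by apply: tsubst_fresh; apply: fresh_notin.
have := @der_eq_subst (fEq t (tVar x)) x u v l isT isT duv.
by rewrite /= eqxx !e => h; apply: h.
Qed.

(** Leibniz for $w[x\mapsto t]=w[x\mapsto y]$ in the fresh variable $y$, so that the left side stays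
    fixed. *)
Lemma der_eq_congr w x t u l : der (fEq t u :: l) ->
  der (fEq (tsubst x t w) (tsubst x u w) :: l).
Proof.
move=> d; pose y := fresh (x :: tfv w ++ tfv t).
have /norP[yx /norP[yw yt]] : ~~ [|| y == x, y \in tfv w | y \in tfv t].
  by rewrite -mem_cat -in_cons fresh_notin.
have e v : tsubst y v (tsubst x (tVar y) w) = tsubst x v w by exact: tsubst_var.
have f v : tsubst y v (tsubst x t w) = tsubst x t w.
  by rewrite tsubst_fresh // mem_tfv_tsubst (negbTE yw) (negbTE yt) !andbF.
have := @der_eq_subst (fEq (tsubst x t w) (tsubst x (tVar y) w)) y t u l isT isT d.
rewrite /= !e !f => h; apply: h; apply: (@der_refl (tsubst x t w)); exact: mem_head.
Qed.

Lemma der_eq_succ t u l : der (fEq t u :: l) -> der (fEq (tSucc t) (tSucc u) :: l).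
Proof. exact: (@der_eq_congr (tSucc (tVar 0)) 0). Qed.

Lemma der_eq_addr v t u l :
  der (fEq t u :: l) -> der (fEq (tAdd v t) (tAdd v u) :: l).
Proof.
move=> d; have := @der_eq_congr (tAdd v (tVar (fresh (tfv v)))) (fresh (tfv v)) t u l d.
by rewrite /= eqxx !tsubst_fresh ?fresh_notin.
Qed.

End Derivations.

(** * Robinson arithmetic *)

Definition sum_vars (Z : seq nat) : term :=
  foldr (fun z t => tAdd (tVar z) t) tZero Z.

Lemma tfv_sum_vars Z : tfv (sum_vars Z) = Z.
Proof. by elim: Z => //= z Z ->. Qed.

Section Robinson.

Variables U C : formula -> Prop.
Hypothesis QU : forall A, A \in Q_axioms -> U A.
Hypothesis C_eq : forall t u, C (fEq t u).

Local Notation der := (der U C).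

Lemma der_Q A : A \in Q_axioms -> der [:: A].
Proof. by move=> /QU UA; apply: (der_axiom _ UA); apply: mem_head. Qed.

Lemma der_succ_neq0 t l : der (fNeq (tSucc t) tZero :: l).
Proof.
have d : der [:: fAll 0 (fNeq (tSucc (tVar 0)) tZero)] by apply: der_Q; rewrite inE eqxx.
have /(_ isT) := der_all_elim (t := t) _ d; apply: der_sub; sub_tac.
Qed.

Lemma der_add0 t l : der (fEq (tAdd t tZero) t :: l).
Proof.
have d : der [:: fAll 0 (fEq (tAdd (tVar 0) tZero) (tVar 0))].
  by apply: der_Q; rewrite !inE eqxx ?orbT.
have /(_ isT) := der_all_elim (t := t) _ d; apply: der_sub; sub_tac.
Qed.

Lemma der_mul0 t l : der (fEq (tMul t tZero) tZero :: l).
Proof.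
have d : der [:: fAll 0 (fEq (tMul (tVar 0) tZero) tZero)].
  by apply: der_Q; rewrite !inE eqxx ?orbT.
have /(_ isT) := der_all_elim (t := t) _ d; apply: der_sub; sub_tac.
Qed.

(* The variables a and b keep t and u away from the quantifiers of the axiom. *)
Lemma der_inst2 A t u : bv A = [::] -> der [:: fAll 0 (fAll 1 A)] ->
  exists a b, [/\ (a == 1) = false, (b == a) = false, tsubst b u t = t &
    der [:: subst b u (subst a t (subst 1 (tVar b) (subst 0 (tVar a) A)))]].
Proof.
move=> bA d; pose a := fresh [:: 0; 1]; pose b := fresh ([:: a; 0; 1] ++ tfv t).
have ha : a \notin [:: 0; 1] by exact: fresh_notin.
have /norP[hb bt] : ~~ ((b \in [:: a; 0; 1]) || (b \in tfv t)).
  by rewrite -mem_cat fresh_notin.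
have ff x v B : bv B = [::] -> free_for x v B.
  by move=> e; apply: free_for_bv; rewrite e.
exists a, b; split.
- by move: ha; rewrite !inE negb_or => /andP[_ /negbTE].
- by move: hb; rewrite inE negb_or => /andP[/negbTE].
- exact: tsubst_fresh.
have fa : free_for 0 (tVar a) (fAll 1 A).
  move: ha; rewrite !inE !negb_or => /andP[_ a1].
  by rewrite /= ff // inE eq_sym a1 orbT.
have {}d : der [:: fAll 1 (subst 0 (tVar a) A)] by exact: (der_all_elim fa d).
apply: (@der_subst _ _ b u [:: _]).
  by move=> B; rewrite inE => /eqP ->; apply: ff; rewrite !bv_subst.
apply: (@der_subst _ _ a t [:: _]).
  by move=> B; rewrite inE => /eqP ->; apply: ff; rewrite !bv_subst.
by apply: der_all_elim d; apply: ff; rewrite bv_subst.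
Qed.

Lemma der_succ_inj t u l : der (fNeq (tSucc t) (tSucc u) :: fEq t u :: l).
Proof.
have [|a [b [a1 ba bt]]] := @der_inst2
  (fImp (fEq (tSucc (tVar 0)) (tSucc (tVar 1))) (fEq (tVar 0) (tVar 1))) t u erefl.
  by apply: der_Q; rewrite !inE eqxx ?orbT.
rewrite /= a1 /= !eqxx ba /= !eqxx !bt.
by move=> /der_or_elim d; apply: der_sub d; sub_tac.
Qed.

Lemma der_addS t u l : der (fEq (tAdd t (tSucc u)) (tSucc (tAdd t u)) :: l).
Proof.
have [|a [b [a1 ba bt]]] := @der_inst2
  (fEq (tAdd (tVar 0) (tSucc (tVar 1))) (tSucc (tAdd (tVar 0) (tVar 1)))) t u erefl.
  by apply: der_Q; rewrite !inE eqxx ?orbT.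
rewrite /= a1 /= !eqxx ba /= !eqxx !bt.
by move=> d; apply: der_sub d; sub_tac.
Qed.

Lemma der_mulS t u l : der (fEq (tMul t (tSucc u)) (tAdd (tMul t u) t) :: l).
Proof.
have [|a [b [a1 ba bt]]] := @der_inst2
  (fEq (tMul (tVar 0) (tSucc (tVar 1)))
     (tAdd (tMul (tVar 0) (tVar 1)) (tVar 0))) t u erefl.
  by apply: der_Q; rewrite !inE eqxx ?orbT.
rewrite /= a1 /= !eqxx ba /= !eqxx !bt.
by move=> d; apply: der_sub d; sub_tac.
Qed.

Lemma der_zero_or_succ z y l : z != y ->
  der (fEq (tVar z) tZero :: fEx y (fEq (tVar z) (tSucc (tVar y))) :: l).
Proof.
(* Instantiating the axiom by [z] directly would risk capture when [z] is 1. So it is instantiated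
   by a fresh [a], the bound variable is renamed to [y], and only then is [a] replaced by [z]. *)
move=> zy; pose a := fresh [:: 0; 1; y]; pose b := fresh [:: a; 0; 1; y].
have := fresh_notin [:: 0; 1; y]; rewrite -/a !inE !negb_or => /and3P[a0 a1 ay].
have := fresh_notin [:: a; 0; 1; y]; rewrite -/b !inE !negb_or => /and4P[ba b0 b1 b_y].
have d : der [:: fAll 0 (fOr (fEq (tVar 0) tZero)
                           (fEx 1 (fEq (tVar 0) (tSucc (tVar 1)))))].
  by apply: der_Q; rewrite !inE eqxx ?orbT.
have fa : (1 \notin [:: a]) && true by rewrite inE eq_sym a1.
have {fa d}/(_ fa)/= /der_or_elim d := der_all_elim (t := tVar a) _ d.
suff d' : der [:: fEq (tVar a) tZero; fEx y (fEq (tVar a) (tSucc (tVar y)))].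
  have := @der_subst _ _ a (tVar z) _ _ d'; rewrite /= eqxx [y == a]eq_sym (negbTE ay).
  move=> h; apply: der_sub (h _); first by sub_tac.
  move=> A; rewrite !inE => /orP[/eqP->//|/eqP-> /=].
  by rewrite [y \in _]inE [y == z]eq_sym zy orbT.
apply: (@der_cut _ _ (fEx 1 (fEq (tVar a) (tSucc (tVar 1))))).
  by apply: der_sub d; sub_tac.
apply: (@der_all _ _ _ _ b) => //.
  by rewrite !fvs_cons !mem_cat /= a1 ay /= eqxx /= !inE (negbTE ba).
rewrite /= (negbTE a1).
apply: (@der_sub _ _ [:: fEx y (fEq (tVar a) (tSucc (tVar y)));
   fNeq (tVar a) (tSucc (tVar b)); fEq (tVar a) tZero]); first by sub_tac.
apply: (@der_ex _ _ _ _ (tVar b)) => //.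
rewrite /= eqxx (negbTE ay).
by apply: (@der_id _ _ (fEq (tVar a) (tSucc (tVar b)))); mem_tac.
Qed.

(** Rule (case) follows from $z=0\vee\exists y\,z=s(y)$ by Leibniz. Since [z] does not occur in [l],
    the successor premiss can be generalised over [z] and instantiated by a fresh [y]. *)
Lemma der_case_formula z A l : z \notin fvs l -> der (subst z tZero A :: l) ->
  der (subst z (tSucc (tVar z)) A :: l) -> der (A :: l).
Proof.
move=> zl d0 dS; pose y := fresh (z :: bv A ++ fv A ++ fvs l).
have := fresh_notin (z :: bv A ++ fv A ++ fvs l); rewrite -/y inE !mem_cat !negb_or.
move=> /and4P[yz ybA yA yl].
have {d0}d0 : der (A :: fNeq (tVar z) tZero :: l).
  have := der_leibniz (u := tVar z) _ (free_for_id _ _) d0.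
  rewrite subst_id => {}d0.
  have {}d0 : der [:: A, fNeq tZero (tVar z) & l] by apply/d0/free_for_bv.
  apply: (@der_cut _ _ (fEq tZero (tVar z))).
    apply: der_eq_sym.
    by apply: (@der_id _ _ (fEq (tVar z) tZero)); mem_tac.
  by apply: der_sub d0; sub_tac.
have {dS}dS : der (A :: fNeq (tVar z) (tSucc (tVar y)) :: l).
  have ff u : tfv u = [:: y] -> free_for z u A.
    by move=> e; apply: free_for_bv => x; rewrite e inE => /eqP ->.
  have {}dS : der (fAll z (subst z (tSucc (tVar z)) A) :: l).
    apply: (@der_all _ _ _ _ z); rewrite ?free_for_id ?subst_id //.
    by rewrite fvs_cons mem_cat (negbTE (notin_fv_all _ _)).
  have {dS} := der_all_elim (t := tVar y) _ dS.
  rewrite subst_succ_var => dS.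
  have {dS}/= dS : der (subst z (tSucc (tVar y)) A :: l).
    by apply/dS/free_for_bv => x; rewrite inE bv_subst => /eqP ->.
  have {}dS := der_leibniz (ff (tSucc (tVar y)) erefl) (free_for_id _ _) dS.
  rewrite subst_id in dS.
  apply: (@der_cut _ _ (fEq (tSucc (tVar y)) (tVar z))).
    apply: der_eq_sym.
    by apply: (@der_id _ _ (fEq (tVar z) (tSucc (tVar y)))); mem_tac.
  by apply: der_sub dS; sub_tac.
have {}dS : der (fAll y (fNeq (tVar z) (tSucc (tVar y))) :: A :: l).
  apply: (@der_all _ _ _ _ y); rewrite ?free_for_id ?subst_id //.
    by rewrite !fvs_cons !mem_cat (negbTE (notin_fv_all _ _)) (negbTE yA) (negbTE yl).
  by apply: der_sub dS; sub_tac.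
apply: (@der_cut _ _ (fEq (tVar z) tZero)); last by apply: der_sub d0; sub_tac.
apply: (@der_cut _ _ (fEx y (fEq (tVar z) (tSucc (tVar y))))); last first.
  by apply: der_sub dS; sub_tac.
have zy : z != y by rewrite eq_sym.
by apply: der_sub (der_zero_or_succ (A :: l) zy); sub_tac.
Qed.

Lemma der_case z G l : z \notin fvs l ->
  der ([seq subst z tZero A | A <- G] ++ l) ->
  der ([seq subst z (tSucc (tVar z)) A | A <- G] ++ l) -> der (G ++ l).
Proof.
move=> zl d0 dS; apply/der_ors; apply: (@der_case_formula z) => //.
  by rewrite subst_ors; apply/der_ors.
by rewrite subst_ors; apply/der_ors.
Qed.

(** The axioms recur on the right summand, so moving a successor out of the left one takes (IR),
    here for an equation. Variables stand for [t] and [u] during the induction and are replaced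
    afterwards. *)
Lemma der_succ_add t u l : der (fEq (tAdd (tSucc t) u) (tSucc (tAdd t u)) :: l).
Proof.
pose x := fresh (tfv u); pose y := fresh [:: x].
have xu : x \notin tfv u by exact: fresh_notin.
have := fresh_notin [:: x]; rewrite -/y inE => yx.
have d : der [:: fAll y (fEq (tAdd (tSucc (tVar x)) (tVar y))
                             (tSucc (tAdd (tVar x) (tVar y))))].
  apply: der_IR => //=; rewrite eqxx eq_sym (negbTE yx).
    apply: (der_eq_trans (der_add0 _ _)); apply: der_eq_sym; apply: der_eq_succ.
    exact: der_add0.
  set hyp := fNeq _ _.
  apply: (@der_sub _ _ [:: fEq (tAdd (tSucc (tVar x)) (tSucc (tVar y)))
      (tSucc (tAdd (tVar x) (tSucc (tVar y)))); hyp]); first by sub_tac.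
  apply: (der_eq_trans (der_addS _ _ _)).
  apply: (@der_eq_trans _ _ (tSucc (tSucc (tAdd (tVar x) (tVar y))))).
    by apply: der_eq_succ; apply: (@der_id _ _ (fneg hyp)); rewrite /hyp; mem_tac.
  by apply: der_eq_sym; apply: der_eq_succ; apply: der_addS.
have {d}/(_ isT)/= d := der_all_elim (t := u) _ d.
rewrite eqxx eq_sym (negbTE yx) in d.
have {d} := @der_subst _ _ x t _ _ d; rewrite /= eqxx !(tsubst_fresh _ xu) => d.
by apply: der_sub (d _); [sub_tac | move=> A; rewrite inE => /eqP ->].
Qed.

(** As [Z] has no repetitions, exactly one summand grows; its successor is then moved outwards
    through the sum. *)
Lemma der_sum_vars_succ Z z l : uniq Z -> z \in Z ->
  der (fEq (tsubst z (tSucc (tVar z)) (sum_vars Z)) (tSucc (sum_vars Z)) :: l).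
Proof.
elim: Z => //= x Z IH /andP[xZ uZ]; rewrite inE eq_sym.
have [<- _|nxz /= zZ] := eqVneq x z.
  by rewrite tsubst_fresh ?tfv_sum_vars //; apply: der_succ_add.
apply: (der_eq_trans (der_eq_addr _ (IH uZ zZ))); exact: der_addS.
Qed.

End Robinson.

(** * Soundness of the inferences *)

Lemma sub_mset1D A (G : sequent) (l : seq formula) :
  A \in l -> {subset G <= l} -> {subset enum_mset (A +` G) <= l}.
Proof. by move=> Al Gl B; rewrite [_ \in _]in_mset1D => /orP[/eqP->|/Gl]. Qed.

Lemma mset1D_sub A (G : sequent) (l : seq formula) :
  {subset l <= G} -> {subset A :: l <= enum_mset (A +` G)}.
Proof.
move=> lG B; rewrite [X in _ -> is_true X]in_mset1D inE.
by move=> /orP[->//|/lG ->]; rewrite orbT.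
Qed.

Section Rules.

Variables U C T : formula -> Prop.
Hypothesis QU : forall A, A \in Q_axioms -> U A.
Hypothesis TU : forall A, T A -> U A.

Local Notation der := (der U C).

Lemma der_mset1D A (G : sequent) D :
  der ((A +` G : sequent) ++ D) <-> der (A :: G ++ D).
Proof.
split; apply: der_sub.
  by apply: sub_catl; [apply: sub_mset1D; [mem_tac | sub_tac] | sub_tac].
by rewrite -cat_cons; apply: sub_catl; [apply/sub_catr1/mset1D_sub | sub_tac].
Qed.

Lemma der_mset2D A B (G : sequent) D :
  der ((A +` (B +` G) : sequent) ++ D) <-> der (A :: B :: G ++ D).
Proof.
split; apply: der_sub.
  apply: sub_catl; last by sub_tac.
  by apply: sub_mset1D; [mem_tac | apply: sub_mset1D; [mem_tac | sub_tac]].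
rewrite -!cat_cons; apply: sub_catl; last by sub_tac.
by apply/sub_catr1/mset1D_sub/mset1D_sub.
Qed.

Lemma der_mset3D A B E (G : sequent) D :
  der ((A +` (B +` (E +` G)) : sequent) ++ D) <-> der (A :: B :: E :: G ++ D).
Proof.
split; apply: der_sub.
  apply: sub_catl; last by sub_tac.
  apply: sub_mset1D; [mem_tac | apply: sub_mset1D; [mem_tac|]].
  by apply: sub_mset1D; [mem_tac | sub_tac].
rewrite -!cat_cons; apply: sub_catl; last by sub_tac.
by apply/sub_catr1/mset1D_sub/mset1D_sub/mset1D_sub.
Qed.

(* The context D must avoid the active variables of the non-vacuous
   quantifiers only: a vacuous one can be introduced with any fresh variable. *)
Lemma der_inference r D :
  side_condition T r -> (forall G y, r <> iCase G y) ->
  (forall G y A z, r = iAll G y A z -> y \in fv A -> z \notin fvs D) ->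
  (forall b P, premiss r b = Some P -> der (P ++ D)) ->
  der (conclusion r ++ D).
Proof.
case: r => [G t0 t1|G t|A|G A B|G A B|G y A z|G y A t|G t|G t0 t1 y u0 u1|G t|
  G t u|G t|G t u|G t0 t1|G y|G E|G A] /= side ncase fresh_z prem.
- by apply/der_mset2D; apply: (@der_id _ _ (fEq t0 t1)); mem_tac.
- by apply/der_mset1D; apply: der_succ_neq0.
- apply: (der_axiom _ (TU side)); apply: mem_catl.
  by rewrite in_mset1.
- apply/der_mset1D; apply: der_and; apply/der_mset1D.
    exact: (prem false).
  exact: (prem true).
- apply/der_mset1D; apply: der_or; apply/der_mset2D; exact: (prem false).
- have /der_mset1D d := prem false _ erefl; apply/der_mset1D.
  have [yA|yA] := boolP (y \in fv A).
    case: side => ff zG; apply: (@der_all _ _ _ _ z) => //.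
    rewrite -cat_cons fvs_cat mem_cat negb_or (fresh_z _ _ _ _ erefl yA) andbT.
    rewrite -(@mem_fv_sequent (fAll y A +` G)) // => B.
    by rewrite in_mset1D inE.
  pose w := fresh (bv A ++ fvs (fAll y A :: G ++ D)).
  have /norP[wA wl] : ~~ ((w \in bv A) || (w \in fvs (fAll y A :: G ++ D))).
    by rewrite -mem_cat fresh_notin.
  apply: (@der_all _ _ _ _ w) => //.
    by apply: free_for_bv => x; rewrite inE => /eqP ->.
  by rewrite subst_fresh // in d; rewrite subst_fresh.
- apply/der_mset1D; apply: (@der_ex _ _ _ _ t) => //; apply/der_mset2D.
  exact: (prem false).
- have /der_mset1D d := prem false _ erefl.
  by apply: (der_cut d); apply: (@der_refl _ _ t); mem_tac.
- have /der_mset3D d := prem false _ erefl; apply/der_mset2D.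
  (* Leibniz for $u_0=u_1$, from $t_0$ to $t_1$, refutes the formula that the premiss of (rep)
     adds. *)
  apply: (@der_cut _ _ (subst y t1 (fNeq u0 u1))).
    by apply: der_sub d; sub_tac.
  have h := @der_leibniz U C (fEq u0 u1) y t0 t1
    (subst y t0 (fNeq u0 u1) :: G ++ D) isT isT.
  apply: der_sub (h _); first by sub_tac.
  by apply: (@der_id _ _ (subst y t0 (fEq u0 u1))); mem_tac.
- have /der_mset1D d := prem false _ erefl.
  by apply: (der_cut d); apply: der_add0.
- have /der_mset1D d := prem false _ erefl.
  by apply: (der_cut d); apply: der_addS.
- have /der_mset1D d := prem false _ erefl.
  by apply: (der_cut d); apply: der_mul0.
- have /der_mset1D d := prem false _ erefl.
  by apply: (der_cut d); apply: der_mulS.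
- have /der_mset2D d := prem false _ erefl; apply/der_mset1D.
  apply: (@der_cut _ _ (fNeq t0 t1)); first by apply: der_sub d; sub_tac.
  by apply: der_sub (der_succ_inj _ QU t0 t1 (G ++ D)); sub_tac.
- by have := ncase G y.
- apply: der_sub (prem false _ erefl); apply: sub_catl; last by sub_tac.
  by move=> B BG; apply: mem_catl; rewrite in_msetD BG.
- have /der_mset1D d := prem false _ erefl.
  have /der_mset1D d' := prem true _ erefl; exact: der_cut d d'.
Qed.

Lemma der_subst_sequent y t (G : sequent) D :
  der (subst_sequent y t G ++ D) <-> der ([seq subst y t A | A <- G] ++ D).
Proof.
split; apply: der_sub => A; rewrite !mem_cat /subst_sequent mem_seq_mset //.
Qed.

(** With an empty context the conditions on it hold trivially, and (case) is admissible as well. *)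
Lemma derivable_inference r : side_condition T r ->
  (forall b P, premiss r b = Some P -> derivable U C P) ->
  derivable U C (conclusion r).
Proof.
move=> side prem; apply/der_mset; rewrite -[X in der X]cats0.
have prem' b P : premiss r b = Some P -> der (P ++ [::]).
  by move=> /prem d; rewrite cats0; apply/der_mset.
case: r side prem prem' => [G t0 t1|G t|A|G A B|G A B|G y A z|G y A t|G t|
  G t0 t1 y u0 u1|G t|G t u|G t|G t u|G t0 t1|G y|G E|G A] side prem prem';
  try by apply: der_inference.
apply: (@der_case _ _ QU y) => //; apply/der_subst_sequent.
  exact: (prem' false).
exact: (prem' true).
Qed.

(** The fold is to the left, so the induction merges the first two disjuncts into one. *)
Lemma derivable_big_or (G : sequent) : derivable U C G -> derivable U C [mset big_or G].
Proof.
move=> /der_mset; rewrite -seq_mset1 -/(der _) /big_or.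
case: (G : seq formula) => [|A l]; first by apply: der_sub; sub_tac.
elim: l A => [//|B l IH] A d /=; apply: IH; apply: der_or.
by apply: der_sub d; sub_tac.
Qed.

End Rules.

(** * Reading inferences off sequents *)

(* The constants are chosen so that the change of weight from the conclusion
   to the left premiss separates (case) from the other binary rules and (forall)
   from the other unary rules. *)
Fixpoint weight (A : formula) : nat :=
  match A with
  | fEq _ _ | fNeq _ _ => 2
  | fAnd A1 A2 => (weight A1 + weight A2).+1
  | fOr A1 A2 => (weight A1 + weight A2).+2
  | fAll _ A1 | fEx _ A1 => (weight A1).+1
  end.

Definition sweight (G : sequent) : nat := \sum_(A <- G) weight A.

Lemma weight_ge2 A : 2 <= weight A.
Proof. by elim: A => //= *; lia. Qed.

Lemma weight_subst y t A : weight (subst y t A) = weight A.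
Proof.
by elim: A => //= [A -> B ->|A -> B ->|x A IH|x A IH] //; case: ifP => //= _; rewrite IH.
Qed.

Lemma sweightD (G D : sequent) : sweight (G `+` D) = sweight G + sweight D.
Proof.
rewrite /sweight -big_cat /=; apply: perm_big; apply/allP => A _ /=.
by rewrite count_cat !count_mem_mset !msetE2.
Qed.

Lemma sweight1 A : sweight [mset A] = weight A.
Proof. by rewrite /sweight enum_msetn big_seq1. Qed.

(* As for [sub_tac], rewriting would compare distinct sequents up to conversion. *)
Ltac unfold_sweight :=
  repeat match goal with
  | |- context [sweight (?G `+` ?D)] =>
      generalize (sweightD G D); generalize (sweight (G `+` D)); intro
  | |- context [sweight [mset ?A]] =>
      generalize (sweight1 A); generalize (sweight [mset A]); intro
  end.

Lemma sweight_subst y t G : sweight (subst_sequent y t G) = sweight G.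
Proof.
rewrite /sweight /subst_sequent (perm_big _ (perm_eq_seq_mset _)) big_map /=.
by apply: eq_bigr => A _; rewrite weight_subst.
Qed.

(** Separates (weak) from (forall), whose premiss is lighter than the conclusion by exactly one. *)
Lemma sweight_gt1 (G : sequent) : sweight G != 1.
Proof.
rewrite /sweight; case: (G : seq formula) => [|A l]; first by rewrite big_nil.
by rewrite big_cons; have := weight_ge2 A; lia.
Qed.

Lemma mem_fv_subst_sequent x y t (G : sequent) : {subset tfv t <= [:: y]} ->
  (x \in fv_sequent (subst_sequent y t G)) =
  (x != y) && (x \in fv_sequent G) || (y \in fv_sequent G) && (x \in tfv t).
Proof.
move=> ty; have mem v A := @mem_fv_subst v y t A (free_for_same_var A ty).
apply/flatten_mapP/orP => [[B]|].
  rewrite /subst_sequent [_ \in _]mem_seq_mset => /mapP[A AG ->]; rewrite mem.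
  case/orP=> /andP[h1 h2]; [left|right]; apply/andP; split => //.
    by apply/flatten_mapP; exists A.
  by apply/flatten_mapP; exists A.
case=> /andP[]; [move=> xy /flatten_mapP[A AG xA] | move=> /flatten_mapP[A AG xA] xt].
  exists (subst y t A); first by rewrite [_ \in _]mem_seq_mset; apply: map_f.
  by rewrite mem xy xA.
exists (subst y t A); first by rewrite [_ \in _]mem_seq_mset; apply: map_f.
by rewrite mem xA xt orbT.
Qed.

Lemma mem_fv_sequentD x (G D : sequent) :
  (x \in fv_sequent (G `+` D)) = (x \in fv_sequent G) || (x \in fv_sequent D).
Proof.
rewrite (@mem_fv_sequent _ (G ++ D)) ?fvs_cat ?mem_cat // => A.
by rewrite in_msetD mem_cat.
Qed.

Lemma mem_fv_sequent1 x A : (x \in fv_sequent [mset A]) = (x \in fv A).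
Proof. by rewrite /fv_sequent enum_msetn /= cats0. Qed.

(** Among the binary rules, the left premiss is lighter than the conclusion for the conjunction
    rule, heavier for (cut) and equally heavy for (case). The active variable is the one that the
    left premiss loses. *)
Lemma case_determined T r (G : sequent) y :
  side_condition T r -> y \in fv_sequent G -> conclusion r = G ->
  (forall b, premiss r b = premiss (iCase G y) b) -> r = iCase G y.
Proof.
case: r => [G' t0 t1|G' t|A|G' A B|G' A B|G' y' A z|G' y' A t|G' t|G' t0 t1 y' u0 u1|G' t|
  G' t u|G' t|G' t u|G' t0 t1|G' y'|G' E|G' A] /= side yG eG prem;
  try by have := prem true.
- have := prem false; rewrite -eG => /Some_inj/(congr1 sweight).
  by rewrite sweight_subst !sweightD !sweight1 /=; lia.
- rewrite eG in prem *; have [->//|nyy'] := eqVneq y' y.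
  have := prem false => /Some_inj/(congr1 fv_sequent)/(congr1 (fun l => y \in l)).
  by rewrite !mem_fv_subst_sequent // eqxx yG [y == y']eq_sym (negbTE nyy').
- have := prem false; rewrite -eG => /Some_inj/(congr1 sweight).
  by rewrite sweight_subst !sweightD !sweight1; have := weight_ge2 A; lia.
Qed.

(** Among the unary rules only (forall) loses exactly one unit of weight. As the quantifier is not
    vacuous, [z] is the variable free in the premiss but not in the conclusion; the principal
    formula may differ. *)
Lemma all_determined T r (G : sequent) y A z :
  side_condition T r -> side_condition T (iAll G y A z) -> y \in fv A ->
  conclusion r = conclusion (iAll G y A z) ->
  (forall b, premiss r b = premiss (iAll G y A z) b) ->
  exists G' y' A', r = iAll G' y' A' z.
Proof.
move=> side [ff zG] yA concl prem; have sw := congr1 sweight concl.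
case: r side sw concl prem => [G' t0 t1|G' t|A'|G' A' B|G' A' B|G' y' A' z'|
  G' y' A' t|G' t|G' t0 t1 y' u0 u1|G' t|G' t u|G' t|G' t u|G' t0 t1|G' y'|G' E|G' A'] /=
  side sw concl prem;
  try by [have := congr1 isSome (prem true) | have := congr1 isSome (prem false)];
  have /Some_inj e := prem false; have := congr1 sweight e; move: sw;
  unfold_sweight; rewrite /= ?weight_subst; try by clear; lia.
- do 10?move=> _; exists G', y', A'; congr iAll; case: side => ff' zG'.
  apply/eqP/negPn/negP => zz'.
  have : z \in fv_sequent (subst y (tVar z) A +` G).
    by rewrite mem_fv_sequentD mem_fv_sequent1 mem_fv_subst // yA inE eqxx orbT.
  move: zG; rewrite -e -concl !mem_fv_sequentD !mem_fv_sequent1 mem_fv_subst //.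
  rewrite inE [z == z']eq_sym (negbTE zz') andbF orbF negb_or /= mem_filter.
  by move=> /andP[/negbTE-> /negbTE ->].
- by have := sweight_gt1 E; clear; lia.
Qed.

(** * Bad nodes and looping branches *)

Section Trees.

Variables (T : formula -> Prop) (t : inference_tree).
Hypothesis correct : locally_correct T t.
Implicit Types (p q w : seq bool) (b : bool).

Lemma node_correct p r : t p = Some r ->
  side_condition T r /\ forall b, marking t (rcons p b) = premiss r b.
Proof. by have := correct p; case: (t p) => // r' h [<-]. Qed.

Lemma marking_node p G : marking t p = Some G ->
  exists2 r, t p = Some r & conclusion r = G.
Proof. by rewrite /marking; case: (t p) => //= r /Some_inj <-; exists r. Qed.

Lemma node_prefix p w : isSome (t (p ++ w)) -> isSome (t p).
Proof.
elim/last_ind: w => [|w b IH]; first by rewrite cats0.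
rewrite -rcons_cat => h; apply: IH; case e: (t (p ++ w)) => //.
by have := correct (p ++ w); rewrite e => /(_ b) hb; rewrite hb in h.
Qed.

(** Equality of the marked subtrees, as in [regular]; the inferences at the two nodes may differ. *)
Definition bisimilar p q : Prop :=
  forall w, marking t (p ++ w) = marking t (q ++ w).

Lemma bisimilar_sym p q : bisimilar p q -> bisimilar q p.
Proof. by move=> h w. Qed.

Lemma bisimilar_trans p q w : bisimilar p q -> bisimilar q w -> bisimilar p w.
Proof. by move=> h h' v; rewrite h. Qed.

Lemma bisimilar_cat p q w : bisimilar p q -> bisimilar (p ++ w) (q ++ w).
Proof. by move=> h v; rewrite -!catA. Qed.

Lemma bisimilar_marking p q : bisimilar p q -> marking t p = marking t q.
Proof. by move=> /(_ [::]); rewrite !cats0. Qed.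

Lemma bisimilar_rcons p q b : bisimilar p q -> bisimilar (rcons p b) (rcons q b).
Proof. by rewrite -!cats1; apply: bisimilar_cat. Qed.

Lemma bisimilar_node p q r : bisimilar p q -> t p = Some r ->
  exists r', [/\ t q = Some r', side_condition T r', side_condition T r,
    conclusion r' = conclusion r & forall b, premiss r' b = premiss r b].
Proof.
move=> pq tp; have [side prem] := node_correct tp.
have /esym/marking_node [r' tq cr'] : Some (conclusion r) = marking t q.
  by rewrite -(bisimilar_marking pq) /marking tp.
have [side' prem'] := node_correct tq.
exists r'; split=> // b; rewrite -prem -prem'.
exact/esym/bisimilar_marking/bisimilar_rcons.
Qed.

Lemma bisimilar_case p q G y : bisimilar p q ->
  t p = Some (iCase G y) -> t q = Some (iCase G y).
Proof.
move=> pq /(bisimilar_node pq)[r [-> side' side concl prem]]; congr Some.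
exact: case_determined side' side concl prem.
Qed.

Lemma bisimilar_all p q G y A z : bisimilar p q -> y \in fv A ->
  t p = Some (iAll G y A z) -> exists G' y' A', t q = Some (iAll G' y' A' z).
Proof.
move=> pq yA /(bisimilar_node pq)[r [-> side' side concl prem]].
have [G' [y' [A' ->]]] := all_determined side' side yA concl prem.
by exists G', y', A'.
Qed.

(** The addresses extend each other strictly, so they are initial segments of a single branch. *)
Lemma branch_of_chain (f : nat -> seq bool) :
  (forall j, isSome (t (f j))) ->
  (forall j, exists b w, f j.+1 = f j ++ b :: w) ->
  exists beta, infinite_branch t beta /\
    forall j k, k <= size (f j) -> mkseq beta k = take k (f j).
Proof.
move=> tf fS.
have f_size j : j <= size (f j).
  elim: j => // j IH; have [b [w ->]] := fS j; rewrite size_cat /=; lia.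
have f_mono i j : i <= j -> exists w, f j = f i ++ w.
  move=> /subnK <-; elim: (j - i) => [|d [w e]]; first by exists [::]; rewrite cats0.
  have [b [w' ->]] := fS (d + i); exists (w ++ b :: w'); by rewrite e catA.
(* [f k.+1] has more than [k] entries, so the default is never read. *)
pose beta k := nth false (f k.+1) k.
have mk j k : k <= size (f j) -> mkseq beta k = take k (f j).
  move=> kj; apply: (@eq_from_nth _ false); first by rewrite size_mkseq size_takel.
  rewrite size_mkseq => i ik; rewrite nth_mkseq // nth_take // /beta.
  have [ij|ji] := leqP i.+1 j.
    have [w ->] := f_mono _ _ ij; rewrite nth_cat.
    by have := f_size i.+1 => ->.
  have [w ->] := f_mono j i.+1 (ltnW ji); rewrite nth_cat.
  by rewrite (leq_trans ik kj).
exists beta; split=> // k; rewrite (mk k) //.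
by apply: (@node_prefix _ (drop k (f k))); rewrite cat_take_drop.
Qed.

(** Dependent choice of children inside [P], starting at [p]. *)
Lemma branch_in (P : seq bool -> Prop) p :
  (forall q, P q -> isSome (t q)) -> (forall q, P q -> exists b, P (rcons q b)) ->
  P p -> exists beta, infinite_branch t beta /\
    forall k, size p <= k -> P (mkseq beta k).
Proof.
move=> Pt PS Pp.
have /choice[g gP] : forall q, exists b, P q -> P (rcons q b).
  move=> q; have [/PS[b Pb]|nPq] := pselect (P q); first by exists b.
  by exists true => /nPq.
pose f := fix f j := if j is i.+1 then rcons (f i) (g (f i)) else p.
have Pf j : P (f j) by elim: j => //= j; apply: gP.
have [||beta [branch mk]] := @branch_of_chain f.
- by move=> j; apply: Pt.
- by move=> j /=; exists (g (f j)), [::]; rewrite cats1.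
exists beta; split=> // k pk.
have sz j : size (f j) = j + size p by elim: j => //= j; rewrite size_rcons => ->.
by rewrite (mk (k - size p)) ?take_oversize ?sz ?subnK.
Qed.

End Trees.

(** * The component of bad nodes around a recurrent one *)

Section Component.

Variables (T C U : formula -> Prop) (t : inference_tree).
Hypothesis correct : locally_correct T t.
Hypothesis QU : forall A, A \in Q_axioms -> U A.
Hypothesis TU : forall A, T A -> U A.
Implicit Types (p q w : seq bool) (b : bool).

Definition bad p : Prop :=
  exists2 G, marking t p = Some G & ~ derivable U C G.

Lemma bad_node p : bad p -> isSome (t p).
Proof. by move=> [G]; rewrite /marking; case: (t p). Qed.

Lemma bisimilar_bad p q : bisimilar t p q -> bad p -> bad q.
Proof. by move=> /bisimilar_marking e [G]; rewrite e => *; exists G. Qed.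

(** Soundness of a single inference, read contrapositively; in particular no leaf is bad. *)
Lemma bad_child p : bad p -> exists b, bad (rcons p b).
Proof.
move=> [G /marking_node[r tp <-] nd].
have [side prem] := node_correct correct tp.
apply: contrapT => h; apply: nd; apply: (derivable_inference QU TU side) => b P eP.
apply: contrapT => nP; apply: h; exists b, P => //.
by rewrite prem.
Qed.

(** Both ends are included: [take i w] is [w] for all large [i], so [i] can be left unbounded. *)
Definition bad_path p w : Prop := forall i, bad (p ++ take i w).

Lemma bad_path_nil p : bad p -> bad_path p [::].
Proof. by move=> h i; rewrite /= cats0. Qed.

Lemma bad_path_end p w : bad_path p w -> bad (p ++ w).
Proof. by move=> /(_ (size w)); rewrite take_size. Qed.

Lemma bad_path_cat p w w' :
  bad_path p w -> bad_path (p ++ w) w' -> bad_path p (w ++ w').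
Proof.
move=> h h' i; rewrite take_cat; case: ifP => _; first exact: h.
by rewrite catA; apply: h'.
Qed.

Lemma bad_path_rcons p w b :
  bad_path p w -> bad (rcons (p ++ w) b) -> bad_path p (rcons w b).
Proof.
move=> h hb; rewrite -cats1; apply: bad_path_cat => // -[|i] /=.
  by rewrite cats0; apply: bad_path_end.
by rewrite cats1.
Qed.

Lemma bisimilar_bad_path p q w : bisimilar t p q -> bad_path p w -> bad_path q w.
Proof. by move=> h hw i; apply: bisimilar_bad (hw i); apply: bisimilar_cat. Qed.

(* A bad node with as few bad classes reachable from it as possible. *)
Lemma recurrent_bad_node p : regular t -> bad p ->
  exists2 p0, bad p0 & forall w, bad_path p0 w ->
    exists2 w', bad_path (p0 ++ w) w' & bisimilar t (p0 ++ w ++ w') p0.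
Proof.
move=> [s0 reg]; pose s := undup s0.
have {}reg q : bad q -> exists2 q', q' \in s & bisimilar t q q'.
  by move=> /bad_node/reg[q' q's h]; exists q'; rewrite ?mem_undup.
pose reach q q' := exists2 w, bad_path q w & bisimilar t (q ++ w) q'.
pose R q := [seq q' <- s | `[< reach q q' >]].
have [k] := ubnP (size (R p)); elim: k p => // k IH p pk bp.
have [min|] := pselect (forall w, bad_path p w -> size (R p) <= size (R (p ++ w))).
  exists p => // w hw.
  have sub : {subset R (p ++ w) <= R p}.
    move=> q; rewrite !mem_filter => /andP[/asboolP[w' hw' e] ->]; rewrite andbT.
    apply/asboolP; exists (w ++ w'); first exact: bad_path_cat.
    by rewrite catA.
  (* Minimality turns the inclusion into equality of sets, so the class of [p] itself stays
     reachable from [p ++ w]. *)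
  have [_ eqR] := uniq_min_size (filter_uniq _ (undup_uniq _)) sub (min w hw).
  have [q0 q0s pq0] := reg p bp.
  have : q0 \in R p.
    rewrite mem_filter q0s andbT; apply/asboolP; exists [::]; first exact: bad_path_nil.
    by rewrite cats0.
  rewrite -eqR mem_filter => /andP[/asboolP[w' hw' e] _]; exists w' => //.
  rewrite catA; apply: bisimilar_trans e _; exact: bisimilar_sym.
move=> /existsNP[w /not_implyP[hw /negP]]; rewrite -ltnNge => lt.
by apply: (IH (p ++ w)); [exact: leq_trans lt _ | exact: bad_path_end].
Qed.

Variable p0 : seq bool.
Hypothesis bad_p0 : bad p0.
Hypothesis recurrent : forall w, bad_path p0 w ->
  exists2 w', bad_path (p0 ++ w) w' & bisimilar t (p0 ++ w ++ w') p0.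

Definition inB p : Prop := exists2 w, p = p0 ++ w & bad_path p0 w.

Lemma inB_bad p : inB p -> bad p.
Proof. by move=> [w ->]; apply: bad_path_end. Qed.

Lemma inB_root : inB p0.
Proof. by exists [::]; rewrite ?cats0 //; apply: bad_path_nil. Qed.

Lemma inB_child p b : inB p -> bad (rcons p b) -> inB (rcons p b).
Proof.
by move=> [w -> hw] hb; exists (rcons w b); rewrite ?rcons_cat //; apply: bad_path_rcons.
Qed.

(** Return to a copy of [p0], then follow there the path that leads from [p0] to [q]. *)
Lemma inB_reach p q : inB p -> inB q -> exists2 w, inB (p ++ w) & bisimilar t (p ++ w) q.
Proof.
move=> [w1 -> hw1] [w2 -> hw2]; have [w' hw' e] := recurrent hw1.
have e' : bisimilar t ((p0 ++ w1) ++ w') p0 by rewrite -catA.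
exists (w' ++ w2).
  exists (w1 ++ w' ++ w2); first by rewrite !catA.
  apply: bad_path_cat => //; apply: bad_path_cat => //.
  by apply: bisimilar_bad_path hw2; apply: bisimilar_sym.
by rewrite catA; apply: bisimilar_cat.
Qed.

(** [e] is a schedule of edges, and the branch travels to a copy of each in turn. The [j]-th one is
    passed at depth at least [j], so a tail from depth [N] passes all edges scheduled from [N]
    on. *)
Lemma looping_branch (e : nat -> seq bool * bool) :
  (forall j, inB (e j).1 /\ bad (rcons (e j).1 (e j).2)) ->
  exists2 beta, infinite_branch t beta & forall j, exists k,
    [/\ j <= k, bisimilar t (mkseq beta k) (e j).1 & beta k = (e j).2].
Proof.
move=> he.
have step j p : inB p ->
    exists w, inB (rcons (p ++ w) (e j).2) /\ bisimilar t (p ++ w) (e j).1.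
  move=> Bp; have [Be be] := he j; have [w Bw pw] := inB_reach Bp Be.
  exists w; split=> //; apply: inB_child => //; apply: bisimilar_bad be.
  exact/bisimilar_rcons/bisimilar_sym.
have /choice[g gP] : forall x : nat * seq bool, exists w, inB x.2 ->
    inB (rcons (x.2 ++ w) (e x.1).2) /\ bisimilar t (x.2 ++ w) (e x.1).1.
  move=> [j p]; have [/(step j)[w h]|nB] := pselect (inB p); first by exists w.
  by exists [::] => /nB.
pose f := fix f j := if j is i.+1 then rcons (f i ++ g (i, f i)) (e i).2 else p0.
have Bf j : inB (f j).
  by elim: j => [|j IH] /=; [exact: inB_root | have [] := gP (j, f j) IH].
have fS j : exists b w, f j.+1 = f j ++ b :: w.
  rewrite /= rcons_cat; case: (g (j, f j)) => [|b w] /=.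
    by exists (e j).2, [::].
  by exists b, (rcons w (e j).2).
have [|beta [branch mk]] := branch_of_chain correct (f := f) _ fS.
  by move=> j; exact/bad_node/inB_bad.
have f_size j : j <= size (f j).
  elim: j => // j IH; have [b [w ->]] := fS j; rewrite size_cat /=; lia.
exists beta => // j; have [_ bis] := gP (j, f j) (Bf j).
set p := f j ++ g (j, f j) in bis; have fj : f j.+1 = rcons p (e j).2 by [].
exists (size p); split.
- by rewrite size_cat (leq_trans (f_size j)) // leq_addr.
- by rewrite (mk j.+1) fj ?size_rcons // -cats1 take_size_cat.
- have := mk j.+1 (size p).+1; rewrite fj size_rcons leqnn take_oversize ?size_rcons //.
  by move=> /(_ isT); rewrite mkseqS => /rcons_inj[].
Qed.

Variable n : nat.
Hypothesis good : forall beta, infinite_branch t beta ->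
  exists N, good_tail n t beta N.

(** Looping through the left edge would violate condition (a) in every tail. *)
Lemma inB_case_left p G y : inB p -> t p = Some (iCase G y) -> ~ bad (rcons p false).
Proof.
move=> Bp tp bp; have [//|beta br loop] := @looping_branch (fun=> (p, false)).
have [N gt] := good br; have [k [Nk /bisimilar_sym pk bk]] := loop N.
by have := tail_a gt Nk (bisimilar_case correct pk tp); rewrite bk.
Qed.

Lemma inB_case_right p G y : inB p -> t p = Some (iCase G y) -> bad (rcons p true).
Proof.
move=> Bp tp; have [[] //] := bad_child (inB_bad Bp).
by move=> /(inB_case_left Bp tp).
Qed.

Lemma inB_case_Pi p G y : inB p -> t p = Some (iCase G y) ->
  forall A, A \in G -> Pi n.+1 A.
Proof.
move=> Bp tp; have [|beta br loop] := @looping_branch (fun=> (p, true)).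
  by move=> _; split=> //; exact: inB_case_right tp.
have [N gt] := good br; have [k [Nk /bisimilar_sym pk bk]] := loop N.
exact: (tail_g gt Nk (bisimilar_case correct pk tp) bk).
Qed.

(** Condition (b), on a branch that alternates between the (case) edge and the (forall) edge. *)
Lemma inB_active_variable p G z q G' y A z' :
  inB p -> t p = Some (iCase G z) ->
  inB q -> t q = Some (iAll G' y A z') -> y \in fv A -> z' <> z.
Proof.
move=> Bp tp Bq tq yA.
have bq : bad (rcons q false).
  have [[] //] := bad_child (inB_bad Bq).
  by move=> [P]; have [_ ->] := node_correct correct tq.
have [|beta br loop] :=
  @looping_branch (fun j => if odd j then (q, false) else (p, true)).
  by move=> j; case: odd; split=> //; exact: inB_case_right tp.
have [N gt] := good br.
(* An even index selects the (case) edge, at a depth [k] inside the tail; an odd index beyond [k]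
   then selects the (forall) edge further up. *)
have [k [Nk]] := loop N.*2; rewrite odd_double /= => /bisimilar_sym pk bk.
have [j [kj]] := loop k.*2.+1; rewrite /= odd_double /= => /bisimilar_sym qj bj.
have [G1 [y1 [A1 tj]]] := bisimilar_all correct qj yA tq.
apply: (tail_b gt _ (bisimilar_case correct pk tp) bk _ tj).
  by rewrite -addnn in Nk; lia.
by rewrite -addnn in kj; lia.
Qed.

(** Condition (c): a good tail meets (case). [P] will be the set of unproved nodes of the
    component. *)
Lemma inB_case_reached (P : seq bool -> Prop) p :
  (forall q, P q -> isSome (t q)) -> (forall q, P q -> exists b, P (rcons q b)) ->
  (forall q G y, P q -> t q <> Some (iCase G y)) -> ~ P p.
Proof.
move=> Pt PS Pcase Pp; have [beta [br h]] := branch_in correct Pt PS Pp.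
have [N gt] := good br; have [y /(_ (size p))[k [G [_ pk tk _]]]] := tail_c gt.
exact: Pcase (h k pk) tk.
Qed.

End Component.

(** * The induction *)

(** The two claims are proved together, since each class is built over the other one at the level
    below. *)
Lemma Delta0_Sigma_Pi m A : Delta0 A -> Sigma m A /\ Pi m A.
Proof.
move=> dA; elim: m => // m [sA pA].
by split; [exact: ex_closure_base | exact: all_closure_base].
Qed.

Lemma Pi_atom m t u : Pi m (fEq t u) /\ Pi m (fNeq t u).
Proof.
have [_ pe] := Delta0_Sigma_Pi m (Delta0_eq t u).
by have [_ pn] := Delta0_Sigma_Pi m (Delta0_neq t u).
Qed.

Lemma Pi_ors m l : {in l, forall A, Pi m.+1 A} -> Pi m.+1 (ors l).
Proof.
elim: l => [|A l IH] h; first by have [] := Pi_atom m.+1 tZero tZero.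
apply: all_closure_or; first by apply: h; exact: mem_head.
by apply: IH => B Bl; apply: h; exact: mem_consr.
Qed.

Lemma Pi_ands m l : {in l, forall A, Pi m.+1 A} -> Pi m.+1 (ands l).
Proof.
elim: l => [|A l IH] h; first by have [] := Pi_atom m.+1 tZero tZero.
apply: all_closure_and; first by apply: h; exact: mem_head.
by apply: IH => B Bl; apply: h; exact: mem_consr.
Qed.

Lemma Pi_alls m xs A : Pi m.+1 A -> Pi m.+1 (alls xs A).
Proof. by elim: xs => //= x xs IH /IH; apply: all_closure_all. Qed.

(** * Descent along the value of the sum *)

Section Descent.

Variables (U C : formula -> Prop).
Hypothesis QU : forall A, A \in Q_axioms -> U A.
Local Notation der := (der U C).

(** For the base of the induction, with $S'=S[y\mapsto s(y)]$. *)
Lemma der_sum_succ_neq0 S S' l :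
  der (fEq S' (tSucc S) :: l) -> der (fNeq S' tZero :: l).
Proof.
move=> e; apply: (@der_cut _ _ (fEq (tSucc S) tZero)); last exact: der_succ_neq0.
apply: (@der_eq_trans _ _ S').
  by apply: der_eq_sym; apply: der_sub e; sub_tac.
by apply: (@der_id _ _ (fEq S' tZero)); mem_tac.
Qed.

(** For the induction step: if $S'=s(S)$ had the value $s(u)$, then $S$ would have the value $u$. *)
Lemma der_sum_pred S S' u l :
  der (fEq S' (tSucc S) :: l) -> der (fNeq S u :: l) -> der (fNeq S' (tSucc u) :: l).
Proof.
move=> e d; apply: (@der_cut _ _ (fEq (tSucc S) (tSucc u))).
  apply: (@der_eq_trans _ _ S').
    by apply: der_eq_sym; apply: der_sub e; sub_tac.
  by apply: (@der_id _ _ (fEq S' (tSucc u))); mem_tac.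
apply: (@der_cut _ _ (fEq S u)).
  by apply: der_sub (der_succ_inj _ QU S u l); sub_tac.
by apply: der_sub d; sub_tac.
Qed.

End Descent.

(** * The induction formula and the refutation of bad nodes *)

Section Soundness.

Variables (n : nat) (T : formula -> Prop) (t : inference_tree).
Hypothesis correct : locally_correct T t.
Hypothesis good : forall beta, infinite_branch t beta ->
  exists N, good_tail n t beta N.
Hypothesis reg : regular t.

Local Notation U := (Q_plus T).
Local Notation C := (Pi n.+1).
Local Notation der := (der U C).

Let QU A : A \in Q_axioms -> U A. Proof. by left. Qed.
Let TU A : T A -> U A. Proof. by right. Qed.

Lemma no_recurrent_bad_node p0 : bad C U t p0 ->
  ~ (forall w, bad_path C U t p0 w -> exists2 w', bad_path C U t (p0 ++ w) w' &
       bisimilar t (p0 ++ w ++ w') p0).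
Proof.
move=> bp0 rec; pose B := inB C U t p0.
have [s sP] := reg.
(* Every marking is that of a representative in [s], so this finite list contains all variables free
   in the tree. *)
pose V := flatten [seq oapp fv_sequent [::] (marking t q) | q <- s].
have VP p G : marking t p = Some G -> {subset fv_sequent G <= V}.
  move=> tp x xG; have [|q qs pq] := sP p.
    by move: tp; rewrite /marking; case: (t p).
  by apply/flatten_mapP; exists q => //; rewrite -(bisimilar_marking pq) tp.
pose caseB G y := exists2 p, B p & t p = Some (iCase G y).
(* [Z] and [Gs] list the active variables and the conclusions of the (case) nodes in [B]; [undup]
   makes each variable count once in the sum. *)
pose Z := undup [seq y <- V | `[< exists G, caseB G y >]].
pose Gs := [seq G <- pmap (marking t) s | `[< exists y, caseB G y >]].
have Z_case y : y \in Z -> exists G, caseB G y.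
  by rewrite mem_undup mem_filter => /andP[/asboolP].
have case_Z G y : caseB G y -> y \in Z.
  move=> cB; rewrite mem_undup mem_filter; apply/andP; split.
    by apply/asboolP; exists G.
  have [p Bp tp] := cB; have [side _] := node_correct correct tp.
  by apply: (VP p G) side; rewrite /marking tp.
have Gs_case G : G \in Gs -> exists y, caseB G y.
  by rewrite mem_filter => /andP[/asboolP].
have case_Gs G y : caseB G y -> G \in Gs.
  move=> cB; rewrite mem_filter; apply/andP; split; first by apply/asboolP; exists y.
  have [p Bp tp] := cB; have [|q qs pq] := sP p; first by rewrite tp.
  rewrite mem_pmap; apply/mapP; exists q => //.
  by rewrite -(bisimilar_marking pq) /marking tp.
pose K := ands [seq ors (G : seq formula) | G : sequent <- Gs].
(* Quantifying over these leaves only variables of [u] free in [F u]. *)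
pose xs := Z ++ fv K.
pose N := fresh (V ++ xs).
have /norP[NV Nxs] : ~~ ((N \in V) || (N \in xs)) by rewrite -mem_cat fresh_notin.
have NZ : N \notin Z by move: Nxs; rewrite mem_cat negb_or => /andP[].
have NK : N \notin fv K by move: Nxs; rewrite mem_cat negb_or => /andP[].
pose S := sum_vars Z.
pose F u := alls xs (fOr (fNeq S u) K).
have fvF u x : x \in fv (F u) -> x \in tfv u.
  rewrite mem_fv_alls /= tfv_sum_vars !mem_cat negb_or.
  by case: (x \in Z); case: (x \in tfv u); case: (x \in fv K).
have substF u : subst N u (F (tVar N)) = F u.
  by rewrite subst_alls //= eqxx subst_fresh // tsubst_fresh // tfv_sum_vars.
have PiF u : Pi n.+1 (F u).
  apply: Pi_alls; apply: all_closure_or; first by have [] := Pi_atom n.+1 S u.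
  apply: Pi_ands => A /mapP[G /Gs_case[y [p Bp tp]] ->]; apply: Pi_ors => A' A'G.
  exact: (inB_case_Pi correct QU TU bp0 rec good Bp tp A'G).
(* As side formulas these amount to assuming [F (tVar N)] and that the sum has the value [N]. *)
pose D := [:: fneg (F (tVar N)); fNeq S (tVar N)].
pose proved p := exists2 G, marking t p = Some G & der (G ++ D).
have fvD x : x \in fvs D -> (x \in Z) || (x == N).
  rewrite /D !fvs_cons !mem_cat fv_fneg => /or3P[/fvF||//].
    by rewrite inE => ->; rewrite orbT.
  by rewrite tfv_sum_vars inE.
(* Under [D] one obtains [K], hence the conclusion of any (case) in [B], without recourse to its
   premisses. *)
have proved_case q G y : B q -> t q = Some (iCase G y) -> proved q.
  move=> Bq tq; have GGs : G \in Gs by apply: (case_Gs G y); exists q.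
  exists G; first by rewrite /marking tq.
  apply: (@der_cut _ _ (fOr (fNeq S (tVar N)) K)).
    apply: (@der_sub _ _ (fneg (F (tVar N)) :: fOr (fNeq S (tVar N)) K :: G ++ D)).
      by rewrite /D; sub_tac.
    by apply: der_alls_elim; exact: mem_head.
  rewrite /=; apply: der_and.
    by apply: (@der_id _ _ (fEq S (tVar N))); rewrite /D; mem_tac.
  have dK : der (fneg K :: ors G :: G ++ D).
    by apply: der_ands_elim; exact: (map_f (fun G : sequent => ors G) GGs).
  have {dK}/der_ors dK : der (ors G :: fneg K :: G ++ D) by apply: der_sub dK; sub_tac.
  by apply: der_sub dK; sub_tac.
(* Otherwise unproved nodes of [B] would continue upwards for ever without meeting (case). *)
have provedB p : B p -> proved p.
  move=> Bp; apply: contrapT => np.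
  apply: (inB_case_reached correct good (P := fun q => B q /\ ~ proved q) (p := p)) => //.
  - by move=> q [/inB_bad/bad_node].
  - move=> q [Bq nq]; have bq := inB_bad Bq.
    case tq : (t q) (bad_node bq) => [r|//] _.
    apply: contrapT => nb; apply: (nq).
    exists (conclusion r); first by rewrite /marking tq.
    have [side prem] := node_correct correct tq.
    have good_child b P : premiss r b = Some P -> der (P ++ D).
      move=> eP; have mP : marking t (rcons q b) = Some P by rewrite prem.
      have [bc|nbc] := pselect (bad C U t (rcons q b)).
        have Bc := inB_child Bq bc.
        have [[G mG dG]|nc] := pselect (proved (rcons q b)).
          by have /Some_inj <- : Some G = Some P by rewrite -mG.
        by case: nb; exists b.
      have /der_mset dP : derivable U C P.
        by apply: contrapT => ndP; apply: nbc; exists P.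
      by apply: der_sub dP; sub_tac.
    apply: (der_inference QU TU side) => //.
      by move=> G y er; apply: nq; apply: (proved_case q G y); rewrite -?er.
    (* An active variable free in [D] would lie in [Z], against [inB_active_variable], or be [N],
       although it occurs in the premiss and [N] is outside [V]. *)
    move=> G y A z er yA; apply/negP => /fvD/orP[/Z_case[G' [p' Bp' tp']]|/eqP zN].
      rewrite er in tq.
      exact: (inB_active_variable correct QU TU bp0 rec good Bp' tp' Bq tq yA).
    move: (side) (prem false); rewrite er => -[ff _] /VP/(_ z).
    rewrite mem_fv_sequentD mem_fv_sequent1 mem_fv_subst // yA inE eqxx orbT.
    move=> /(_ isT).
    by rewrite zN (negbTE NV).
  - by move=> q G y [Bq nq] tq; apply: nq; apply: proved_case tq.
(* The left premiss is not bad, so it is derivable without the assumptions [D]. *)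
have left_premiss p G y : B p -> t p = Some (iCase G y) ->
    der [seq subst y tZero A | A <- G].
  move=> Bp tp; have [_ prem] := node_correct correct tp.
  rewrite -[X in der X]cats0; apply/der_subst_sequent; rewrite cats0; apply/der_mset.
  apply: contrapT => nd; apply: (inB_case_left correct bp0 rec good Bp tp).
  by exists (subst_sequent y tZero G) => //; exact: (prem false).
have right_premiss p G y : B p -> t p = Some (iCase G y) ->
    der ([seq subst y (tSucc (tVar y)) A | A <- G] ++ D).
  move=> Bp tp; have [_ prem] := node_correct correct tp.
  have /provedB[G' mG' d] : B (rcons p true).
    by apply: inB_child (inB_case_right correct QU TU bp0 rec good Bp tp).
  apply/der_subst_sequent.
  suff -> : subst_sequent y (tSucc (tVar y)) G = G' by [].
  by apply: Some_inj; rewrite -mG'; exact: (esym (prem true)).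
have S_succ y l : y \in Z -> der (fEq (tsubst y (tSucc (tVar y)) S) (tSucc S) :: l).
  move=> yZ; apply: der_sum_vars_succ => //; last exact: undup_uniq.
  by move=> u v; have [] := Pi_atom n.+1 u v.
have introF u l : {in xs, forall x, x \notin fvs l} ->
    (forall G : sequent, G \in Gs -> der (fNeq S u :: G ++ l)) -> der (F u :: l).
  move=> xl dG; apply: der_alls => //; apply: der_or.
  apply: (@der_sub _ _ (K :: fNeq S u :: l)); first by sub_tac.
  apply: der_ands => _ /mapP[G /dG d ->]; apply/der_ors.
  by apply: der_sub d; sub_tac.
(* For each conclusion in [Gs], split on its active variable. Zero gives the left premiss. For a
   successor the sum grows by one, which excludes the value 0 and reduces the value $s(N)$ to the
   right premiss under [D]. *)
have dF : der [:: fAll N (F (tVar N))].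
  apply: der_IR => //; rewrite substF.
    apply: introF => // G /Gs_case[y [p Bp tp]].
    have yZ : y \in Z by apply: (case_Z G); exists p.
    (* The inequality for the sum belongs to the list on which (case) acts, so its variable is
       replaced too. *)
    apply: (@der_case _ _ QU y (_ :: _)) => //=.
      by apply: der_sub (left_premiss p G y Bp tp); sub_tac.
    by apply: der_sum_succ_neq0 => //; apply: S_succ.
  apply: (@der_sub _ _ [:: F (tSucc (tVar N)); fneg (F (tVar N))]); first by sub_tac.
  have xF x : x != N -> x \notin fvs [:: fneg (F (tVar N))].
    move=> xN; rewrite fvs_cons mem_cat fv_fneg orbF; apply: contra xN => /fvF.
    by rewrite inE.
  apply: introF => [x xxs|G /Gs_case[y [p Bp tp]]].
    by apply: xF; apply: contraNneq Nxs => <-.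
  have yZ : y \in Z by apply: (case_Z G); exists p.
  apply: (@der_case _ _ QU y (_ :: _)) => /=.
  - by apply: xF; apply: contraNneq NZ => <-.
  - by apply: der_sub (left_premiss p G y Bp tp); sub_tac.
  have yN : (N == y) = false by apply/negbTE; apply: contraNneq NZ => ->.
  rewrite yN; apply: (der_sum_pred QU (S_succ y _ yZ)).
  by apply: der_sub (right_premiss p G y Bp tp); rewrite /D; sub_tac.
(* The assumptions [D] are now discharged at [p0]: [F (tVar N)] is a theorem, and [N] is generalised
   and instantiated by the sum itself. *)
have [G mG d] := provedB p0 (inB_root bp0).
have [G' mG' nd] := bp0; apply: nd; have /Some_inj <- : Some G = Some G' by rewrite -mG.
have {dF} dF : der [:: F (tVar N)].
  by have := der_all_elim (free_for_id N _) dF; rewrite subst_id.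
have {}d : der (fNeq S (tVar N) :: G).
  apply: (@der_cut _ _ (F (tVar N))); first by apply: der_sub dF; sub_tac.
  by apply: der_sub d; rewrite /D; sub_tac.
have {}d : der (fAll N (fNeq S (tVar N)) :: G).
  apply: (@der_all _ _ _ _ N); rewrite ?free_for_id ?subst_id //.
  rewrite fvs_cons mem_cat (negbTE (notin_fv_all _ _)) /=.
  by apply: contra NV; apply: (VP p0 G).
have {d}/(_ isT) d := der_all_elim (t := S) _ d.
apply/der_mset; apply: (der_cut d); apply: (@der_refl _ _ S).
by rewrite /= eqxx tsubst_fresh ?tfv_sum_vars //; mem_tac.
Qed.

(** A bad node would yield a recurrent bad node, and there is none. *)
Lemma marking_derivable p G : marking t p = Some G -> derivable U C G.
Proof.
move=> mG; apply: contrapT => nd.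
have [|p0 bp0 rec] := recurrent_bad_node (C := C) (U := U) (p := p) reg.
  by exists G.
exact: no_recurrent_bad_node bp0 rec.
Qed.

End Soundness.

Theorem theorem2 (n : nat) (T : formula -> Prop)
    (hT : forall A : formula, T A -> sentence A) (G : sequent) :
  S_Pi_provable n T G -> theorem_of_Pi_IR (Q_plus T) n.+1 (big_or G).
Proof.
move=> [t [[correct good] reg mG]]; apply: derivable_big_or.
exact: (marking_derivable correct good reg mG).
Qed.
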